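(* Let $\Omega$ be an open, bounded and convex subset of $\mathbb{R}^n$. Let $u$ be an eigenfunction of $\Omega$, that is, a solution of $$\Delta u-\langle\nabla u,x\rangle=-\lambda_\gamma(\Omega)\,u,\quad u>0\quad\text{in }\Omega,\qquad u=0\quad\text{on }\partial\Omega.$$ Then the function $W=-\ln(u)$ is convex in $\Omega$.
   Context: $\gamma$ is the Gaussian measure on $\mathbb{R}^n$, $d\gamma(x)=(2\pi)^{-n/2}e^{-|x|^2/2}\,dx$. For an open bounded set $\Omega\subset\mathbb{R}^n$ with Lipschitz boundary, $$\lambda_\gamma(\Omega)=\inf\left\{\frac{\int_\Omega|\nabla v|^2\,d\gamma}{\int_\Omega v^2\,d\gamma}:\ v\in W^{1,2}_0(\Omega,\gamma),\ v\not\equiv0\right\},$$ where $W^{1,2}_0(\Omega,\gamma)$ is the closure of $C_c^\infty(\Omega)$ in the Sobolev space $W^{1,2}(\Omega,\gamma)$ with respect to the measure $\gamma$. It is classical that $\lambda_\gamma(\Omega)$ is the unique positive number for which the boundary value problem in the statement has a solution, and that the solution is unique up to multiplication by positive constants. Solutions are understood as classical: $u\in C^2(\Omega)\cap C(\overline\Omega)$. *)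

(* Defs.v *)
From HB Require Import structures.
From mathcomp Require Import all_boot all_order all_algebra.
From mathcomp Require Import all_classical all_reals all_analysis.
From mathcomp Require Import measurable_realfun.

Set Implicit Arguments.
Unset Strict Implicit.
Unset Printing Implicit Defensive.

Import Order.TTheory GRing.Theory Num.Theory.
Import numFieldNormedType.Exports.

Local Open Scope classical_set_scope.
Local Open Scope ring_scope.

(* Row vectors carry the sigma-algebra generated by the coordinates, which is
   the Borel sigma-algebra of R^n. *)
Section measurable_rV.
Context (R : realType) (n : nat).

Let coord (i : 'I_n) (x : 'rV[R]_n) : R := x ord0 i.

Let rV_set0 : g_sigma_preimage coord set0.
Proof. exact: sigma_algebra0. Qed.

Let rV_setC A : g_sigma_preimage coord A -> g_sigma_preimage coord (~` A).
Proof. exact: sigma_algebraC. Qed.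

Let rV_bigcup (F : _^nat) : (forall i, g_sigma_preimage coord (F i)) ->
  g_sigma_preimage coord (\bigcup_i (F i)).
Proof. exact: sigma_algebra_bigcup. Qed.

HB.instance Definition _ := @isMeasurable.Build
  (measure_tuple_display default_measure_display)
  'rV[R]_n (g_sigma_preimage coord) rV_set0 rV_setC rV_bigcup.

Lemma measurable_coord (i : 'I_n) :
  measurable_fun [set: 'rV[R]_n] (fun x : 'rV[R]_n => x ord0 i).
Proof.
move=> _ Y mY; rewrite setTI; apply: sub_sigma_algebra => /=.
rewrite -bigcup_seq/=; exists i => /=; first by rewrite mem_index_enum.
by exists Y => //; rewrite setTI.
Qed.

End measurable_rV.

Lemma measurable_fun_rVP (R : realType) n d (T : measurableType d)
    (f : T -> 'rV[R]_n) :
  (forall i, measurable_fun [set: T] (fun t => f t ord0 i)) ->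
  measurable_fun [set: T] f.
Proof.
move=> mf _ B mB; rewrite setTI.
suff : g_sigma_preimage (fun i t => f t ord0 i) `<=` @measurable _ T.
  apply.
  rewrite [X in X _](g_sigma_preimage_comp
    (fun (i : 'I_n) (x : 'rV[R]_n) => x ord0 i) f).
  by exists B => //; rewrite setTI.
apply: smallest_sub; first exact: sigma_algebra_measurable.
move=> A; rewrite -bigcup_seq => -[i _ [C mC <-]].
exact: mf.
Qed.

Lemma sigma_finite_product_measure1 d1 d2 (T1 : measurableType d1)
    (T2 : measurableType d2) (R : realType)
    (m1 : {sigma_finite_measure set T1 -> \bar R})
    (m2 : {sigma_finite_measure set T2 -> \bar R}) :
  sigma_finite setT (m1 \x m2)%E.
Proof.
have /sigma_finiteP[F [TF ndF Foo]] := sigma_finiteT m1.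
have /sigma_finiteP[G [TG ndG Goo]] := sigma_finiteT m2.
exists (fun k => F k `*` G k).
  rewrite -setXTT TF TG predeqE => -[x y]; split.
    move=> [/= [i _ Fx] [j _ Gy]]; exists (maxn i j) => //; split.
    - by move: x Fx; exact/subsetPset/ndF/leq_maxl.
    - by move: y Gy; exact/subsetPset/ndG/leq_maxr.
  by move=> [i _ []/= ? ?]; split; exists i.
move=> k; have [? ?] := Foo k; have [? ?] := Goo k.
split; first exact: measurableX.
by rewrite product_measure1E// lte_mul_pinfty// ge0_fin_numE.
Qed.

Section lebesgue_cons.
Context (R : realType) (n : nat).

Definition cons_rV (p : R * 'rV[R]_n) : 'rV[R]_n.+1 :=
  \row_i (if unlift ord0 i is Some j then p.2 ord0 j else p.1).

Lemma cons_rV0 p : cons_rV p ord0 ord0 = p.1.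
Proof. by rewrite mxE unlift_none. Qed.

Lemma cons_rVS p (i : 'I_n) : cons_rV p ord0 (lift ord0 i) = p.2 ord0 i.
Proof. by rewrite mxE liftK. Qed.

Lemma measurable_cons_rV : measurable_fun setT cons_rV.
Proof.
apply: measurable_fun_rVP => i; have [j ->|->] := unliftP ord0 i.
- under eq_fun do rewrite cons_rVS.
  by apply: (measurableT_comp (measurable_coord j)).
- by under eq_fun do rewrite cons_rV0; exact: measurable_fst.
Qed.

Variable m : {sigma_finite_measure set 'rV[R]_n -> \bar R}.

Definition lebesgue_cons : set 'rV[R]_n.+1 -> \bar R :=
  pushforward (@lebesgue_measure R \x m)%E cons_rV.

Let lebesgue_cons_set0 : lebesgue_cons set0 = 0%E.
Proof. by rewrite /lebesgue_cons /pushforward preimage_set0 measure0. Qed.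

Let lebesgue_cons_ge0 A : (0 <= lebesgue_cons A)%E.
Proof. exact: integral_ge0. Qed.

Let lebesgue_cons_sigma_additive : semi_sigma_additive lebesgue_cons.
Proof.
move=> F mF tF mUF; rewrite /lebesgue_cons /pushforward preimage_bigcup.
apply: measure_semi_sigma_additive.
- by move=> k; rewrite -[X in measurable X]setTI; exact: measurable_cons_rV.
- apply/trivIsetP => /= i j _ _ ij; rewrite -preimage_setI.
  by move/trivIsetP : tF => /(_ _ _ _ _ ij) ->//; rewrite preimage_set0.
- rewrite -preimage_bigcup -[X in measurable X]setTI.
  exact: measurable_cons_rV.
Qed.

HB.instance Definition _ := isMeasure.Build _ _ _ lebesgue_cons
  lebesgue_cons_set0 lebesgue_cons_ge0 lebesgue_cons_sigma_additive.

Let lebesgue_cons_sigma_finite : sigma_finite setT lebesgue_cons.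
Proof.
have [F FT Ffin] : sigma_finite setT (@lebesgue_measure R \x m)%E.
  exact: sigma_finite_product_measure1.
pose h (x : 'rV[R]_n.+1) : R * 'rV[R]_n :=
  (x ord0 ord0, \row_i x ord0 (lift ord0 i)).
have mh : measurable_fun setT h.
  apply: measurable_fun_pair => /=; first exact: measurable_coord.
  apply: measurable_fun_rVP => i; under eq_fun do rewrite mxE.
  exact: measurable_coord.
have hK p : h (cons_rV p) = p.
  case: p => x y; congr pair; first by rewrite cons_rV0.
  by apply/rowP => i; rewrite mxE cons_rVS.
exists (fun k => h @^-1` F k).
  by rewrite -preimage_bigcup -FT preimage_setT.
move=> k; have [mF Foo] := Ffin k; split.
  by rewrite -[X in measurable X]setTI; exact: mh.
rewrite /lebesgue_cons /pushforward -comp_preimage.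
by rewrite (_ : h \o cons_rV = id) //; apply/funext => p; exact: hK.
Qed.

HB.instance Definition _ := Measure_isSigmaFinite.Build _ _ _ lebesgue_cons
  lebesgue_cons_sigma_finite.

End lebesgue_cons.

Fixpoint lebesgue_rV (R : realType) (n : nat) :
    {sigma_finite_measure set 'rV[R]_n -> \bar R} :=
  match n with
  | 0 => \d_(0 : 'rV[R]_0)
  | n'.+1 => lebesgue_cons (lebesgue_rV R n')
  end.

Section gaussian_measure.
Context (R : realType) (n : nat).
Implicit Types x y : 'rV[R]_n.

Definition dotp x y : R := \sum_(i < n) x ord0 i * y ord0 i.

Definition gaussian_density x : R :=
  (2 * pi) `^ (- (n%:R / 2)) * expR (- (dotp x x / 2)).

Lemma gaussian_density_ge0 x : 0 <= gaussian_density x.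
Proof. by rewrite mulr_ge0 ?powR_ge0 ?expR_ge0. Qed.

Lemma measurable_gaussian_density : measurable_fun setT gaussian_density.
Proof.
apply: measurable_funM => //; apply: measurableT_comp => //.
apply: measurableT_comp => //; apply: measurable_funM => //.
by apply: measurable_sum => i; apply: measurable_funM; exact: measurable_coord.
Qed.

Definition gaussian_measure (A : set 'rV[R]_n) : \bar R :=
  (\int[lebesgue_rV R n]_(x in A) (gaussian_density x)%:E)%E.

Let gaussian_measure_set0 : gaussian_measure set0 = 0%E.
Proof. by rewrite /gaussian_measure integral_set0. Qed.

Let gaussian_measure_ge0 A : (0 <= gaussian_measure A)%E.
Proof. by apply: integral_ge0 => x _; rewrite lee_fin gaussian_density_ge0. Qed.

Let gaussian_measure_sigma_additive : semi_sigma_additive gaussian_measure.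
Proof.
apply: semi_sigma_additive_nng_induced.
- by apply/measurable_EFinP; exact: measurable_gaussian_density.
- by move=> x; rewrite lee_fin gaussian_density_ge0.
Qed.

HB.instance Definition _ := isMeasure.Build _ _ _ gaussian_measure
  gaussian_measure_set0 gaussian_measure_ge0 gaussian_measure_sigma_additive.

End gaussian_measure.

Section differential_operators.
Context (R : realType) (n : nat).
Implicit Types (D : set 'rV[R]_n) (f : 'rV[R]_n -> R) (x : 'rV[R]_n).

Definition basis_rV (i : 'I_n) : 'rV[R]_n := delta_mx ord0 i.

Definition partial (i : 'I_n) f : 'rV[R]_n -> R := fun x => 'D_(basis_rV i) f x.

Definition gradient f x : 'rV[R]_n := \row_i partial i f x.

Definition laplacian f x : R := \sum_(i < n) partial i (partial i f) x.

(* [Ck k D f] is meant for open [D], where it says that f is of class C^k: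
   only then do the partial derivatives at points of [D] depend on nothing but
   the restriction of f to [D]. *)
Fixpoint Ck (k : nat) D f : Prop :=
  (forall x, D x -> {for x, continuous f}) /\
  match k with
  | 0 => True
  | k'.+1 => forall i : 'I_n,
      (forall x, D x -> derivable f x (basis_rV i)) /\ Ck k' D (partial i f)
  end.

Definition smooth f : Prop := forall k, Ck k setT f.

(* C_c^oo(Omega), each function being extended by 0 outside Omega *)
Definition test_function (Omega : set 'rV[R]_n) f : Prop :=
  [/\ smooth f, compact (closure [set x | f x != 0]) &
      closure [set x | f x != 0] `<=` Omega].

End differential_operators.

Section gaussian_sobolev.
Context (R : realType) (n : nat).
Variable Omega : set 'rV[R]_n.
Implicit Types (v phi : 'rV[R]_n -> R) (g : 'rV[R]_n -> 'rV[R]_n).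

Local Notation dx := (lebesgue_rV R n).
Local Notation gamma := (@gaussian_measure R n).

Definition L2_gamma v : Prop := measurable_fun Omega v /\
  (\int[gamma]_(x in Omega) (v x ^+ 2)%:E < +oo)%E.

(* The weak gradient is taken with respect to dx, not gamma. *)
Definition weak_gradient v g : Prop :=
  forall phi, test_function Omega phi -> forall i : 'I_n,
    \int[dx]_(x in Omega) (v x * partial i phi x) =
    - \int[dx]_(x in Omega) (g x ord0 i * phi x).

(* v belongs to W^{1,2}(Omega, gamma), with gradient g *)
Definition W12 v g : Prop :=
  [/\ L2_gamma v, forall i : 'I_n, L2_gamma (fun x => g x ord0 i) &
      weak_gradient v g].

(* The square of the norm of W^{1,2}(Omega, gamma) *)
Definition W12_sqnorm v g : \bar R :=
  (\int[gamma]_(x in Omega) (v x ^+ 2)%:E +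
   \int[gamma]_(x in Omega) (dotp (g x) (g x))%:E)%E.

Definition W12_0 v g : Prop := W12 v g /\
  forall e : R, 0 < e -> exists2 phi, test_function Omega phi &
    (W12_sqnorm (v \- phi)%R (g \- gradient phi)%R < (e ^+ 2)%:E)%E.

Definition rayleigh_quotient v g : R :=
  (\int[gamma]_(x in Omega) dotp (g x) (g x)) /
  (\int[gamma]_(x in Omega) (v x ^+ 2)).

Definition lambda_gamma : R := inf [set q | exists v g,
  [/\ W12_0 v g, ~ {ae gamma, forall x, Omega x -> v x = 0} &
      q = rayleigh_quotient v g]].

Definition boundary : set 'rV[R]_n := closure Omega `\` interior Omega.

Definition eigenfunction (u : 'rV[R]_n -> R) : Prop :=
  [/\ Ck 2 Omega u, {within closure Omega, continuous u},
      forall x, Omega x ->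
        laplacian u x - dotp (gradient u x) x = - lambda_gamma * u x,
      forall x, Omega x -> 0 < u x &
      forall x, boundary x -> u x = 0].

End gaussian_sobolev.

(* Main.v *)
(* Fix weights a + b = 1 and extend u by 0. Let P (x, y) = u(x)^a u(y)^b; one has to
   show P (x, y) <= u (a x + b y). If P / g (a x + b y) has an interior local maximum
   for a smooth g > 0, then comparing second derivatives along the diagonal shows
   Lg + lambda g >= 0 at a x + b y, where L = Delta - <x, grad>. Hence P cannot be
   touched from above by a strict supersolution of L + lambda.
   (1) Near the boundary C u plus a small concave function of the distance to a
   supporting hyperplane is a strict supersolution; hence P <= C u holds everywhere
   as soon as it holds for a x + b y in some compact part of Omega. So the best
   constant C with P <= C u is attained in the interior.
   (2) If C > 1, the set where P = C u is closed in Omega and misses the maximum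
   point of u; subtracting Hopf's barrier from C u gives a strict supersolution
   touching P from above. *)

Require Import Defs.
From mathcomp Require Import all_boot all_order all_algebra.
From mathcomp Require Import all_classical all_reals all_analysis.
From mathcomp Require Import ring lra.

Set Implicit Arguments.
Unset Strict Implicit.
Unset Printing Implicit Defensive.

Import Order.TTheory GRing.Theory Num.Theory.
Import numFieldNormedType.Exports.

Local Open Scope classical_set_scope.
Local Open Scope ring_scope.

(** The product of powers of the zero extension is continuous on all pairs and vanishes unless both
    points lie in Omega, so no cases arise according to which point reaches the boundary; sums of
    logarithms would be infinite there. The obstacle is the denominator: [P / u] has no a priori
    bound where [u] vanishes at the image point, and the boundary of a convex set is too rough for a
    Hopf lemma or a smooth distance function. In (1) the function added to [C u] is a multiple of
    one that is at least 1, which keeps the denominator positive up to the boundary, so the quotient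
    has a maximum on a compact set; the half-space that enters it is itself one of the variables of
    the maximisation. In the interior [C u] solves the equation exactly, so a contact alone is no
    contradiction: for [C = 1] the whole diagonal consists of contacts. A strict perturbation below
    [C u] must start from a region free of contacts, and [C > 1] is what provides one, around the
    maximum point of [u]. *)

(** * One-variable calculus and derivatives along lines *)

Lemma is_derive0_local_max (R : realType) (f : R -> R) (df : R) :
  (\forall s \near (0 : R), derivable f s 1) -> is_derive (0 : R) 1 f df ->
  (\forall s \near (0 : R), f s <= f 0) -> df = 0.
Proof.
move=> [e /= e0 fe] dfE [e' /= e'0 fe'].
pose d := Num.min e e'; have d0 : 0 < d by rewrite lt_min e0.
have dE t : t \in `]- d, d[ -> `|0 - t| < e /\ `|0 - t| < e'.
  rewrite in_itv/= sub0r normrN -ltr_norml => td.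
  by split; rewrite (lt_le_trans td)// /d ge_min lexx ?orbT.
have h : is_derive (0 : R) 1 f 0.
  apply: (@derive1_at_max _ _ (- d) d).
  - by rewrite ge0_cp// ltW.
  - by move=> t /dE[? _]; exact: fe.
  - by rewrite in_itv/= d0 oppr_lt0 d0.
  - by move=> t /dE[_ ?]; exact: fe'.
by rewrite -(@derive_val _ _ _ _ _ _ _ dfE) (@derive_val _ _ _ _ _ _ _ h).
Qed.

(** If [c] were positive, then, as [f1 0 = 0], the difference quotient of [f1] at 0 would make [f1]
    positive just to the right of 0, and the mean value theorem would give [f 0 < f d]. *)
Lemma derive2_local_max (R : realType) (f f1 : R -> R) (c : R) :
  (\forall s \near (0 : R), is_derive s (1 : R) f (f1 s)) -> is_derive (0 : R) 1 f1 c ->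
  (\forall s \near (0 : R), f s <= f 0) -> c <= 0.
Proof.
move=> ff1 f1c fmax; rewrite leNgt; apply/negP => c0.
have f10 : f1 0 = 0.
  apply: (is_derive0_local_max _ _ fmax).
    by near=> s; have [] : is_derive s 1 f (f1 s) by near: s.
  exact: (nbhs_singleton ff1).
have [e /= e0 He] : \forall h \near 0^', 0 < h^-1 * f1 h.
  have := @ex_derive _ _ _ _ _ _ _ f1c; rewrite /derivable => cv.
  have : h^-1 *: (f1 (h *: 1 + 0) - f1 0) @[h --> 0^'] --> c.
    rewrite -(@derive_val _ _ _ _ _ _ _ f1c); exact: cv.
  move=> /cvgr_gt/(_ _ c0); apply: filterS => h.
  by rewrite f10 subr0 addr0 [h *: 1]mulr1.
case: ff1 => e1 /= e10 H1; case: fmax => e2 /= e20 H2.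
pose d := Num.min e (Num.min e1 e2) / 2.
have m0 : 0 < Num.min e (Num.min e1 e2) by rewrite !lt_min e0 e10.
have d0 : 0 < d by rewrite divr_gt0.
have dm : d < Num.min e (Num.min e1 e2).
  by rewrite ltr_pdivrMr// ltr_pMr// ltr1n.
move: (dm); rewrite !lt_min => /and3P[de de1 de2].
have Hd s : 0 <= s <= d -> is_derive s 1 f (f1 s).
  move=> /andP[s0 sd]; apply: H1; rewrite /= sub0r normrN ger0_norm//.
  exact: le_lt_trans de1.
have [||z] := @MVT _ f f1 0 d d0.
- by move=> s; rewrite in_itv/= => /andP[s0 sd]; apply: Hd; rewrite !ltW.
- apply: derivable_within_continuous => s.
  by rewrite in_itv/= => sd; have [] := Hd s sd.
rewrite in_itv/= => /andP[z0 zd] fd.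
have fd0 : f d <= f 0 by apply: H2; rewrite /= sub0r normrN ger0_norm ?ltW.
have := He z _ _; rewrite /= sub0r normrN gtr0_norm// => /(_ (lt_trans zd de)).
move=> /(_ (lt0r_neq0 z0)); rewrite pmulr_rgt0 ?invr_gt0// => fz0.
have : 0 < f d - f 0 by rewrite fd subr0 mulr_gt0.
by rewrite subr_gt0 ltNge fd0.
Unshelve. all: by end_near. Qed.

Lemma is_derive_along_line (R : realType) (V : normedModType R) (f : V -> R)
    (x v : V) (s df : R) :
  is_derive (x + s *: v) v f df -> is_derive s 1 (fun s => f (x + s *: v)) df.
Proof.
move=> [fd <-].
have E : (fun h : R => h^-1 *: (f (x + (h *: 1 + s) *: v) - f (x + s *: v))) =
         (fun h : R => h^-1 *: (f (h *: v + (x + s *: v)) - f (x + s *: v))).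
  apply/funext => h; congr (_ *: (f _ - _)).
  by rewrite [h *: 1]mulr1 scalerDl addrCA.
by apply: DeriveDef; [rewrite /derivable/= | rewrite /derive /=]; rewrite E.
Qed.

Lemma is_derive_ln_comp (R : realType) (f : R -> R) (s df : R) :
  0 < f s -> is_derive s 1 f df -> is_derive s 1 (fun s => ln (f s)) (df / f s).
Proof.
move=> fs0 fdf; have lnf := is_derive1_ln fs0.
by rewrite mulrC; exact: (@is_derive1_comp _ _ _ _ _ _ lnf fdf).
Qed.

Lemma is_derive_div (R : realType) (f g : R -> R) (s df dg : R) :
  g s != 0 -> is_derive s 1 f df -> is_derive s 1 g dg ->
  is_derive s 1 (fun s => f s / g s) (df / g s - f s * dg / g s ^+ 2).
Proof.
move=> gs0 fdf gdg.
have gV := @is_deriveV _ _ _ _ _ gs0 gdg.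
apply: is_derive_eq (@is_deriveM _ _ _ _ _ _ _ _ fdf gV) _.
by rewrite /= /GRing.scale/=; field.
Qed.
(** The barriers below are polynomials; with an explicit remainder [r] each of their derivatives
    reduces to one [ring] identity. *)
Lemma is_derive_expansion (R : realType) (V : normedModType R) (f : V -> R)
    (x v : V) (df : R) (r : R -> R) :
  {for 0, continuous r} ->
  (forall h, f (h *: v + x) = f x + h * df + h ^+ 2 * r h) ->
  is_derive x v f df.
Proof.
move=> cr fE.
have cv : h^-1 *: (f (h *: v + x) - f x) @[h --> 0^'] --> df.
  have : df + h * r h @[h --> (0 : R)^'] --> df + 0 * r 0.
    apply: cvgD; first exact: cvg_cst.
    apply: cvg_within_filter; apply: cvgM; first exact: cvg_id.
    exact: cr.
  rewrite mul0r addr0; apply: cvg_trans; apply: near_eq_cvg.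
  near=> h; have h0 : h != 0 by near: h; exact: nbhs_dnbhs_neq.
  by rewrite fE /GRing.scale/=; field.
apply: DeriveDef; first by apply/cvg_ex; exists df.
exact: cvg_lim cv.
Unshelve. all: by end_near. Qed.

Lemma cvg_line (R : realType) (V : normedModType R) (x v : V) (k : R) :
  (fun s : R => x + (k * s) *: v) @ (0 : R) --> x.
Proof.
rewrite [X in _ --> X](_ : x = x + (k * 0) *: v); last first.
  by rewrite mulr0 scale0r addr0.
by apply: cvgD; [exact: cvg_cst|apply: cvgZr_tmp; exact: mulrl_continuous].
Qed.

Lemma near_line (R : realType) (V : normedModType R) (x v : V) (k : R)
    (P : set V) :
  (\forall y \near x, P y) -> \forall s \near (0 : R), P (x + (k * s) *: v).
Proof. by move=> /(@cvg_line R V x v k). Qed.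

Lemma is_derive_line (R : realType) (V : normedModType R) (f : V -> R)
    (x v : V) (k s df : R) :
  is_derive (x + (k * s) *: v) v f df ->
  is_derive s (1 : R) (fun s : R => f (x + (k * s) *: v)) (k * df).
Proof.
move=> /is_derive_along_line h.
have ks : is_derive s (1 : R) (fun s : R => k * s) k.
  by apply: is_derive_eq (is_deriveZ k (is_derive_id s 1)) _; rewrite /= [LHS]mulr1.
by rewrite mulrC; exact: (@is_derive1_comp _ _ _ _ _ _ h ks).
Qed.

(** * First and second order conditions at a two-point maximum *)

Section two_point_maximum.
Variables (R : realType) (V : normedModType R) (u u1 g g1 : V -> R).
Variables (x y v : V) (a b u2x u2y g2z : R).
Let z := a *: x + b *: y.
Hypotheses (a0 : 0 < a) (b0 : 0 < b) (ab1 : a + b = 1).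
Hypotheses (ux0 : \forall w \near x, 0 < u w) (uy0 : \forall w \near y, 0 < u w).
Hypothesis gz0 : \forall w \near z, 0 < g w.
Hypotheses (ux1 : \forall w \near x, is_derive w v u (u1 w))
  (uy1 : \forall w \near y, is_derive w v u (u1 w))
  (gz1 : \forall w \near z, is_derive w v g (g1 w)).
Hypotheses (ux2 : is_derive x v u1 u2x) (uy2 : is_derive y v u1 u2y)
  (gz2 : is_derive z v g1 g2z).
Hypothesis max : \forall p \near (x, y),
  a * ln (u p.1) + b * ln (u p.2) - ln (g (a *: p.1 + b *: p.2)) <=
  a * ln (u x) + b * ln (u y) - ln (g z).

Let line_ln (f f1 : V -> R) (w : V) (k : R) : (\forall w' \near w, 0 < f w') ->
  (\forall w' \near w, is_derive w' v f (f1 w')) ->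
  \forall s \near (0 : R),
    is_derive s (1 : R) (fun s : R => ln (f (w + (k * s) *: v)))
                  (k * f1 (w + (k * s) *: v) / f (w + (k * s) *: v)).
Proof.
move=> f0 ff1; near=> s; apply: is_derive_ln_comp; first by near: s; exact: near_line f0.
apply: is_derive_line; near: s; exact: near_line ff1.
Unshelve. all: by end_near. Qed.

(** Only [x] is moved, at unit speed; then [z] moves at speed [a], and the factor [a] cancels from
    both sides. *)
Lemma two_point_max_gradl : u1 x / u x = g1 z / g z.
Proof.
have xy_line : (fun s : R => (x + (1 * s) *: v, y)) @ (0 : R) --> (x, y).
  by apply: cvg_pair => /=; [exact: cvg_line|exact: cvg_cst].
pose f (s : R) := a * ln (u (x + (1 * s) *: v)) - ln (g (z + (a * s) *: v)).
have df : \forall s \near (0 : R), is_derive s (1 : R) f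
    (a * (1 * u1 (x + (1 * s) *: v) / u (x + (1 * s) *: v)) -
     a * g1 (z + (a * s) *: v) / g (z + (a * s) *: v)).
  near=> s.
  have h1 : is_derive s (1 : R) (fun s : R => ln (u (x + (1 * s) *: v)))
                  (1 * u1 (x + (1 * s) *: v) / u (x + (1 * s) *: v)).
    by near: s; apply: line_ln.
  have h2 : is_derive s (1 : R) (fun s : R => ln (g (z + (a * s) *: v)))
                  (a * g1 (z + (a * s) *: v) / g (z + (a * s) *: v)).
    by near: s; apply: line_ln.
  exact: is_deriveB (is_deriveZ a h1) h2.
have := @is_derive0_local_max R f _ _ (nbhs_singleton df).
rewrite !(mulr0, scale0r, addr0, mul1r).
move=> H; apply: (mulfI (lt0r_neq0 a0)); apply/eqP; rewrite -subr_eq0 mulrA; apply/eqP.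
rewrite -[RHS]H ?mulrA//.
  by near=> s; apply: (@ex_derive _ _ _ _ _ _ _ (near df s _)).
near=> s; rewrite /f !(mulr0, scale0r, addr0).
have : a * ln (u (x + (1 * s) *: v)) + b * ln (u y) -
       ln (g (a *: (x + (1 * s) *: v) + b *: y))
    <= a * ln (u x) + b * ln (u y) - ln (g z).
  near: s; exact: xy_line max.
suff -> : a *: (x + (1 * s) *: v) + b *: y = z + (a * s) *: v by lra.
by rewrite mul1r scalerDr scalerA /z addrAC.
Unshelve. all: by end_near. Qed.

(** Moving [x] and [y] together by [s *: v] moves [z] by the same vector, because [a + b = 1]. The
    second derivative of [ln f] is [f'' / f - (f' / f) ^ 2]; the squares cancel, since the three
    logarithmic derivatives agree and the weights sum to 1. *)
Lemma two_point_max_hess : u1 x / u x = g1 z / g z -> u1 y / u y = g1 z / g z ->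
  a * (u2x / u x) + b * (u2y / u y) <= g2z / g z.
Proof.
move=> px py.
pose f (s : R) := a * ln (u (x + (1 * s) *: v)) + b * ln (u (y + (1 * s) *: v))
  - ln (g (z + (1 * s) *: v)).
pose f1 (s : R) := a * (1 * u1 (x + (1 * s) *: v) / u (x + (1 * s) *: v)) +
  b * (1 * u1 (y + (1 * s) *: v) / u (y + (1 * s) *: v)) -
  1 * g1 (z + (1 * s) *: v) / g (z + (1 * s) *: v).
have df : \forall s \near (0 : R), is_derive s (1 : R) f (f1 s).
  near=> s.
  have h1 : is_derive s (1 : R) (fun s : R => ln (u (x + (1 * s) *: v)))
                  (1 * u1 (x + (1 * s) *: v) / u (x + (1 * s) *: v)).
    by near: s; apply: line_ln.
  have h2 : is_derive s (1 : R) (fun s : R => ln (u (y + (1 * s) *: v)))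
                  (1 * u1 (y + (1 * s) *: v) / u (y + (1 * s) *: v)).
    by near: s; apply: line_ln.
  have h3 : is_derive s (1 : R) (fun s : R => ln (g (z + (1 * s) *: v)))
                  (1 * g1 (z + (1 * s) *: v) / g (z + (1 * s) *: v)).
    by near: s; apply: line_ln.
  exact: is_deriveB (is_deriveD (is_deriveZ a h1) (is_deriveZ b h2)) h3.
have d0 (h h1 : V -> R) (w : V) (h2w : R) : h w != 0 -> is_derive w v h (h1 w) ->
    is_derive w v h1 h2w ->
    is_derive (0 : R) (1 : R)
      (fun s : R => 1 * h1 (w + (1 * s) *: v) / h (w + (1 * s) *: v))
      (h2w / h w - (h1 w / h w) ^+ 2).
  move=> hw0 hh1 h12.
  have w0 : w = w + (1 * 0) *: v by rewrite mulr0 scale0r addr0.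
  rewrite w0 in hh1 h12.
  have := is_derive_div _ (is_deriveZ 1 (is_derive_line h12)) (is_derive_line hh1).
  rewrite /= -w0 => /(_ hw0) h'; apply: is_derive_eq h' _.
  by rewrite /GRing.scale/=; field.
have ux := d0 _ _ _ _ (lt0r_neq0 (nbhs_singleton ux0)) (nbhs_singleton ux1) ux2.
have uy := d0 _ _ _ _ (lt0r_neq0 (nbhs_singleton uy0)) (nbhs_singleton uy1) uy2.
have gz := d0 _ _ _ _ (lt0r_neq0 (nbhs_singleton gz0)) (nbhs_singleton gz1) gz2.
have d1 := is_deriveB (is_deriveD (is_deriveZ a ux) (is_deriveZ b uy)) gz.
have : \forall s \near (0 : R), f s <= f 0.
  near=> s; rewrite /f !(mulr0, scale0r, addr0).
  have : a * ln (u (x + (1 * s) *: v)) + b * ln (u (y + (1 * s) *: v)) -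
       ln (g (a *: (x + (1 * s) *: v) + b *: (y + (1 * s) *: v)))
    <= a * ln (u x) + b * ln (u y) - ln (g z).
    near: s.
    have xy_line : (fun s : R => (x + (1 * s) *: v, y + (1 * s) *: v)) @ (0 : R)
        --> (x, y).
      by apply: cvg_pair => /=; exact: cvg_line.
    exact: xy_line max.
  suff -> : a *: (x + (1 * s) *: v) + b *: (y + (1 * s) *: v) = z + (1 * s) *: v.
    by lra.
  by rewrite !scalerDr addrACA -scalerDl ab1 scale1r.
move=> /(derive2_local_max df d1); rewrite px py /GRing.scale/= => h.
set q := (g1 z / g z) ^+ 2 in h.
have -> : g2z / g z = g2z / g z - q + (a + b) * q by rewrite ab1; ring.
by move: h; rewrite !mulrBr mulrDl; lra.
Unshelve. all: by end_near. Qed.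

End two_point_maximum.

Lemma two_point_max_direction (R : realType) (V : normedModType R)
    (u u1 g g1 : V -> R) (x y v : V) (a b u2x u2y g2z : R) (z := a *: x + b *: y) :
  0 < a -> 0 < b -> a + b = 1 ->
  (\forall w \near x, 0 < u w) -> (\forall w \near y, 0 < u w) ->
  (\forall w \near z, 0 < g w) ->
  (\forall w \near x, is_derive w v u (u1 w)) ->
  (\forall w \near y, is_derive w v u (u1 w)) ->
  (\forall w \near z, is_derive w v g (g1 w)) ->
  is_derive x v u1 u2x -> is_derive y v u1 u2y -> is_derive z v g1 g2z ->
  (\forall p \near (x, y),
    a * ln (u p.1) + b * ln (u p.2) - ln (g (a *: p.1 + b *: p.2)) <=
    a * ln (u x) + b * ln (u y) - ln (g z)) ->
  [/\ u1 x / u x = g1 z / g z, u1 y / u y = g1 z / g z &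
     a * (u2x / u x) + b * (u2y / u y) <= g2z / g z].
Proof.
move=> a0 b0 ab1 ux0 uy0 gz0 ux1 uy1 gz1 ux2 uy2 gz2 max.
have px : u1 x / u x = g1 z / g z by apply: (two_point_max_gradl a0 ux0 gz0 ux1 gz1 max).
suff py : u1 y / u y = g1 z / g z.
  by split => //; exact: (two_point_max_hess ab1 ux0 uy0 gz0 ux1 uy1 gz1 ux2 uy2 gz2 max px py).
(* The condition at [y] is the one at [x] with the two points and the two weights exchanged. *)
have zE : z = b *: y + a *: x by rewrite addrC.
rewrite zE in gz0 gz1 *; apply: (two_point_max_gradl b0 uy0 gz0 uy1 gz1).
near=> p; rewrite [b * _ + _]addrC [b *: p.1 + _]addrC [b * ln (u y) + _]addrC -zE.
near: p; exact: (@swap_continuous V V (y, x) _ max).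
Unshelve. all: by end_near. Qed.

(** * The differential equation at a two-point maximum *)

Section eigenfunction_like.
Variables (R : realType) (n : nat) (Omega : set 'rV[R]_n) (u : 'rV[R]_n -> R).
Variable lam : R.
Hypotheses (oO : open Omega) (u2 : Ck 2 Omega u).
Hypothesis u_gt0 : forall x, Omega x -> 0 < u x.
Hypothesis u_eq : forall x, Omega x ->
  laplacian u x - dotp (gradient u x) x = - lam * u x.

Lemma Ck2_is_derive (i : 'I_n) x : Omega x ->
  is_derive x (basis_rV R i) u (partial i u x).
Proof. by move=> Ox; apply: DeriveDef => //; case: u2 => _ /(_ i)[/(_ x Ox)]. Qed.

Lemma Ck2_is_derive2 (i : 'I_n) x : Omega x ->
  is_derive x (basis_rV R i) (partial i u) (partial i (partial i u) x).
Proof.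
move=> Ox; apply: DeriveDef => //.
by case: u2 => _ /(_ i)[_ [_ /(_ i)[/(_ x Ox)]]].
Qed.

(* At a maximum the logarithmic gradients of [u] at [x], [u] at [y] and [g] at [z]
   agree, and the drift is affine, so all first order terms cancel. *)
Lemma two_point_max_operator (g : 'rV[R]_n -> R) (g1 g2 : 'I_n -> 'rV[R]_n -> R)
    (x y : 'rV[R]_n) (a b : R) (z := a *: x + b *: y) :
  0 < a -> 0 < b -> a + b = 1 -> Omega x -> Omega y ->
  (\forall w \near z, 0 < g w) ->
  (forall i, \forall w \near z, is_derive w (basis_rV R i) g (g1 i w)) ->
  (forall i, is_derive z (basis_rV R i) (g1 i) (g2 i z)) ->
  (\forall p \near (x, y),
    a * ln (u p.1) + b * ln (u p.2) - ln (g (a *: p.1 + b *: p.2)) <=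
    a * ln (u x) + b * ln (u y) - ln (g z)) ->
  - lam * g z <= \sum_(i < n) g2 i z - \sum_(i < n) g1 i z * z ord0 i.
Proof.
move=> a0 b0 ab1 Ox Oy gz0 gz1 gz2 max.
have nO w : Omega w -> \forall w' \near w, Omega w' by move=> Ow; apply: open_nbhs_nbhs; split.
have upos w : Omega w -> \forall w' \near w, 0 < u w'.
  by move=> /nO; apply: filterS => w' /u_gt0.
have uder i w : Omega w ->
    \forall w' \near w, is_derive w' (basis_rV R i) u (partial i u w').
  by move=> /nO; apply: filterS => w' /Ck2_is_derive.
have dir i := two_point_max_direction a0 b0 ab1 (upos _ Ox) (upos _ Oy) gz0
  (uder i _ Ox) (uder i _ Oy) (gz1 i) (Ck2_is_derive2 i Ox) (Ck2_is_derive2 i Oy)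
  (gz2 i) max.
have g0 : 0 < g z by exact: (nbhs_singleton gz0).
have lap w : Omega w -> (forall i, partial i u w / u w = g1 i z / g z) ->
    \sum_(i < n) partial i (partial i u) w / u w =
    - lam + \sum_(i < n) g1 i z / g z * w ord0 i.
  move=> Ow pw; have uw := lt0r_neq0 (u_gt0 Ow).
  rewrite -mulr_suml -/(laplacian u w).
  have /eqP := u_eq Ow; rewrite subr_eq => /eqP ->.
  rewrite mulrDl mulfK//; congr (_ + _).
  rewrite /dotp mulr_suml; apply: eq_bigr => i _.
  by rewrite -pw mxE mulrAC.
have : a * (\sum_(i < n) partial i (partial i u) x / u x) +
       b * (\sum_(i < n) partial i (partial i u) y / u y) <=
       \sum_(i < n) g2 i z / g z.
  rewrite !mulr_sumr -big_split/=; apply: ler_sum => i _.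
  by case: (dir i).
rewrite !lap//; [|by move=> i; case: (dir i)|by move=> i; case: (dir i)].
rewrite -mulr_suml ler_pdivlMr//.
set X := \sum_(i < n) _ * x _ i; set Y := \sum_(i < n) _ * y _ i.
suff -> : \sum_(i < n) g1 i z * z ord0 i = (a * X + b * Y) * g z.
  have -> : a * (- lam + X) + b * (- lam + Y) = - lam * (a + b) + (a * X + b * Y).
    by ring.
  by rewrite ab1 mulr1 mulrDl; lra.
rewrite !mulr_sumr -big_split/= mulr_suml; apply: eq_bigr => i _.
rewrite !mxE; field.
exact: lt0r_neq0.
Qed.

End eigenfunction_like.

(** * Continuity rules and extension by zero *)

Section continuity.
Variables (R : realType) (T : topologicalType).

Lemma continuous_const (U : topologicalType) (c : U) :
  continuous (fun _ : T => c).
Proof. exact: (@cst_continuous T U c). Qed.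

Lemma continuous_compose (U W : topologicalType) (f : T -> U) (g : U -> W) :
  continuous f -> continuous g -> continuous (fun t => g (f t)).
Proof. by move=> cf cg t; apply: continuous_comp; [exact: cf|exact: cg]. Qed.

Lemma continuous_add (V : normedModType R) (f g : T -> V) :
  continuous f -> continuous g -> continuous (fun t => f t + g t).
Proof. by move=> cf cg t; apply: cvgD; [exact: cf|exact: cg]. Qed.

Lemma continuous_sub (V : normedModType R) (f g : T -> V) :
  continuous f -> continuous g -> continuous (fun t => f t - g t).
Proof. by move=> cf cg t; apply: cvgB; [exact: cf|exact: cg]. Qed.

Lemma continuous_scale (V : normedModType R) (k : T -> R) (f : T -> V) :
  continuous k -> continuous f -> continuous (fun t => k t *: f t).
Proof. by move=> ck cf t; apply: cvgZ; [exact: ck|exact: cf]. Qed.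

Lemma continuous_mul (f g : T -> R) :
  continuous f -> continuous g -> continuous (fun t => f t * g t).
Proof. by move=> cf cg t; apply: cvgM; [exact: cf|exact: cg]. Qed.

Lemma continuous_coord n (f : T -> 'rV[R]_n) (i : 'I_n) :
  continuous f -> continuous (fun t => f t ord0 i).
Proof.
move=> cf t; apply: (@continuous_comp _ _ _ f (fun x : 'rV[R]_n => x ord0 i)).
  exact: cf.
exact: coord_continuous.
Qed.

Lemma continuous_sum n (F : 'I_n -> T -> R) : (forall i, continuous (F i)) ->
  continuous (fun t => \sum_(i < n) F i t).
Proof.
move=> cF t; apply: cvg_big => [|i _]; first by apply: add_continuous.
exact: cF.
Qed.

Lemma continuous_dotp n (f g : T -> 'rV[R]_n) :
  continuous f -> continuous g -> continuous (fun t => dotp (f t) (g t)).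
Proof.
move=> cf cg; apply: continuous_sum => i.
by apply: continuous_mul; exact: continuous_coord.
Qed.

Lemma continuous_powR (f : T -> R) (p : R) :
  0 < p -> (forall t, 0 <= f t) -> continuous f -> continuous (fun t => f t `^ p).
Proof.
move=> p0 f0 cf t; have [ft0|] := eqVneq (f t) 0; last first.
  move=> ft0; have {}ft0 : 0 < f t by rewrite lt_neqAle eq_sym ft0 f0.
  apply: (@continuous_comp _ _ _ f (fun x => x `^ p)); first exact: cf.
  apply: differentiable_continuous; apply/derivable1_diffP.
  exact: (@ex_derive _ _ _ _ _ _ _ (is_derive1_powR p ft0)).
rewrite /prop_for/continuous_at ft0 powR0 ?gt_eqF//.
apply/cvgrPdist_lt => e e0; near=> s.
rewrite sub0r normrN ger0_norm ?powR_ge0//.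
(* For an exponent below 1 the power is not differentiable at 0, so at a zero of [f] continuity is
   read off from the threshold given by the [p]-th root of [e]. *)
have -> : e = (e `^ p^-1) `^ p by rewrite -powRrM mulVf ?gt_eqF// powRr1// ltW.
rewrite gt0_ltr_powR// ?nnegrE ?powR_ge0//.
near: s; have /cvgrPdist_lt /(_ (e `^ p^-1)) := cf t.
rewrite powR_gt0// => /(_ isT); apply: filterS => s.
by rewrite ft0 sub0r normrN ger0_norm.
Unshelve. all: by end_near. Qed.

Lemma closed_le_fun (f g : T -> R) :
  continuous f -> continuous g -> closed [set t | f t <= g t].
Proof.
move=> cf cg.
rewrite (_ : [set _ | _] = (fun t => f t - g t) @^-1` [set x | x <= 0]); last first.
  by apply/seteqP; split => t /=; rewrite subr_le0.
apply: preimage_closed => [t _|]; last exact: closed_le.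
exact: (continuous_sub cf cg).
Qed.

Definition zero_ext (D : set T) (u : T -> R) (x : T) : R :=
  if x \in D then u x else 0.

Lemma zero_ext_in (D : set T) (u : T -> R) x : D x -> zero_ext D u x = u x.
Proof. by move=> Dx; rewrite /zero_ext mem_set. Qed.

Lemma zero_ext_out (D : set T) (u : T -> R) x : ~ D x -> zero_ext D u x = 0.
Proof. by move=> Dx; rewrite /zero_ext memNset. Qed.

Lemma zero_ext_continuous (D : set T) (u : T -> R) : open D ->
  {within closure D, continuous u} ->
  (forall x, (closure D `\` interior D) x -> u x = 0) ->
  continuous (zero_ext D u).
Proof.
move=> oD /subspace_continuousP uc u0 x.
have [cx|ncx] := pselect (closure D x); last first.
  have oC : open (~` closure D) by apply: closed_openC; exact: closed_closure.
  have C0 : \near x, zero_ext D u x = 0.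
    have := open_nbhs_nbhs (conj oC ncx); apply: filterS => y ny.
    by apply: zero_ext_out => /subset_closure.
  rewrite /prop_for/continuous_at (nbhs_singleton C0).
  apply: (@cvg_trans _ (cst (0 : R) @ x)); last exact: cvg_cst.
  by apply: near_eq_cvg; apply: filterS C0 => y ->.
have /cvgrPdist_lt ux := uc x cx.
have [Dx|nDx] := pselect (D x).
  apply/cvgrPdist_lt => e e0; have := ux e e0; rewrite !near_withinE => h.
  rewrite (zero_ext_in _ Dx).
  have := open_nbhs_nbhs (conj oD Dx); apply: filterS2 h => y yh Dy.
  by rewrite (zero_ext_in _ Dy); apply: yh; exact: subset_closure.
have ux0 : u x = 0 by apply: u0; split => // /interior_subset.
apply/cvgrPdist_lt => e e0; have := ux e e0; rewrite !near_withinE.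
apply: filterS => y yh; rewrite (zero_ext_out _ nDx) /zero_ext.
case: ifPn => [/set_mem Dy|_]; last by rewrite subrr normr0.
by have := yh (subset_closure Dy); rewrite /from_subspace ux0.
Qed.

End continuity.

(** * Scalar product, convex sets and half-spaces *)

Section dotp_theory.
Variables (R : realType) (n : nat).
Implicit Types x y z : 'rV[R]_n.

Lemma dotpC x y : dotp x y = dotp y x.
Proof. by apply: eq_bigr => i _; rewrite mulrC. Qed.

Lemma dotpDl x y z : dotp (x + y) z = dotp x z + dotp y z.
Proof. by rewrite -big_split; apply: eq_bigr => i _; rewrite mxE mulrDl. Qed.

Lemma dotpZl k x y : dotp (k *: x) y = k * dotp x y.
Proof. by rewrite mulr_sumr; apply: eq_bigr => i _; rewrite mxE mulrA. Qed.

Lemma dotpNl x y : dotp (- x) y = - dotp x y.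
Proof. by rewrite -scaleN1r dotpZl mulN1r. Qed.

Lemma dotpBl x y z : dotp (x - y) z = dotp x z - dotp y z.
Proof. by rewrite dotpDl dotpNl. Qed.

Lemma dotpZr k x y : dotp x (k *: y) = k * dotp x y.
Proof. by rewrite dotpC dotpZl dotpC. Qed.

Lemma dotpDr x y z : dotp x (y + z) = dotp x y + dotp x z.
Proof. by rewrite dotpC dotpDl !(dotpC x). Qed.

Lemma dotpBr x y z : dotp x (y - z) = dotp x y - dotp x z.
Proof. by rewrite dotpC dotpBl !(dotpC x). Qed.

Lemma dotp0l y : dotp 0 y = 0.
Proof. by rewrite -(scale0r y) dotpZl mul0r. Qed.

Lemma dotp_ge0 x : 0 <= dotp x x.
Proof. by apply: sumr_ge0 => i _; rewrite -expr2 sqr_ge0. Qed.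

Lemma dotp_eq0 x : (dotp x x == 0) = (x == 0).
Proof.
apply/idP/eqP => [|->]; last first.
  by rewrite /dotp big1// => i _; rewrite mxE mul0r.
rewrite psumr_eq0 => [/allP x0|i _]; last by rewrite -expr2 sqr_ge0.
apply/rowP => i; have := x0 i; rewrite mem_index_enum => /(_ isT).
by rewrite /= -expr2 sqrf_eq0 => /eqP ->; rewrite mxE.
Qed.

Lemma dotp_gt0 x y : x <> y -> 0 < dotp (x - y) (x - y).
Proof. by move=> /eqP xy; rewrite lt_neqAle eq_sym dotp_eq0 subr_eq0 xy dotp_ge0. Qed.

Lemma bounded_dotp (A : set 'rV[R]_n) (c : R) :
  (forall x, A x -> dotp x x <= c) -> bounded_set A.
Proof.
(* The matrix norm is the maximum of the coordinates; [2 * |t| <= t ^ 2 + 1] bounds each of them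
   without a square root. *)
move=> Ac; exists (c + 1); split; first exact: num_real.
move=> M cM x /Ac xc; have c0 : 0 <= c := le_trans (dotp_ge0 x) xc.
rewrite /= [`|x|]mx_normrE; apply/bigmax_leP; split => [|[i j] _]/=.
  by rewrite (le_trans _ (ltW cM))// addr_ge0.
rewrite ord1 (le_trans _ (ltW cM))//.
have : x ord0 j ^+ 2 <= c.
  apply: le_trans xc; rewrite /dotp (bigD1 j)//= -expr2 lerDl.
  by apply: sumr_ge0 => k _; rewrite -expr2 sqr_ge0.
rewrite -real_normK ?num_real// => h.
have := sqr_ge0 (`|x ord0 j| - 1); rewrite sqrrB1 => h2; lra.
Qed.

Lemma dotp_basis (i : 'I_n) y : dotp (basis_rV R i) y = y ord0 i.
Proof.
rewrite /dotp (bigD1 i)//= big1 => [|j ji]; last first.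
  by rewrite mxE eqxx (negbTE ji) mul0r.
by rewrite mxE !eqxx mul1r addr0.
Qed.

Lemma basis_rVE (i : 'I_n) : basis_rV R i ord0 i = 1.
Proof. by rewrite mxE !eqxx. Qed.

End dotp_theory.

Lemma convex_set_comb (R : realType) (n : nat) (Omega : set 'rV[R]_n) x y (a b : R) :
  convex_set Omega -> 0 < a -> 0 < b -> a + b = 1 -> Omega x -> Omega y ->
  Omega (a *: x + b *: y).
Proof.
move=> cO a0 b0 ab Ox Oy.
have a1 : a <= 1 by lra.
have := cO x y (Itv01 (ltW a0) a1) (mem_set Ox) (mem_set Oy).
have -> : b = 1 - a by lra.
by move=> /set_mem.
Qed.

(** Cauchy-Schwarz against a unit vector, obtained without square roots by expanding the square of
    [a - h *: e]. *)
Lemma dotp_lt_unit (R : realType) (n : nat) (a e : 'rV[R]_n) (h : R) :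
  0 < h -> dotp e e = 1 -> dotp a a < h ^+ 2 -> dotp a e < h.
Proof.
move=> h0 ee ah; have := dotp_ge0 (a - h *: e).
rewrite dotpBl !dotpBr !dotpZr !dotpZl ee (dotpC e) mulr1 => hh.
have : 2 * h * dotp a e < 2 * h * h by nra.
by rewrite ltr_pM2l// mulr_gt0.
Qed.

(** A point [z'] of Omega close to [z] is projected to a nearest point [w] of the complement, and
    the hyperplane through [w] orthogonal to [z' - w] bounds a half-space containing Omega. Both [z]
    and [w] are within [d / 2] of [z'], whence the bound [d]. An approximate support suffices later
    and avoids passing to a limit of normals. *)
Lemma convex_set_almost_support (R : realType) (n : nat) (Omega : set 'rV[R]_n)
    (z : 'rV[R]_n) (d : R) :
  open Omega -> convex_set Omega -> closure Omega z -> ~ Omega z -> 0 < d ->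
  exists e b, [/\ dotp e e = 1, forall y, Omega y -> b <= dotp y e &
                  dotp z e - b < d].
Proof.
move=> oO cO clz nOz d0.
pose h := d / 2; have h0 : 0 < h by rewrite divr_gt0.
have cdist (w : 'rV[R]_n) : continuous (fun x : 'rV[R]_n => dotp (x - w) (x - w)).
  have cw : continuous (fun x : 'rV[R]_n => x - w).
    by apply: continuous_sub; [move=> ?|exact: continuous_const].
  exact: continuous_dotp.
have [z' [Oz' z'z]] : Omega `&` [set x | dotp (x - z) (x - z) < h ^+ 2] !=set0.
  apply: clz; have /cvgr_lt := cdist z z; apply.
  by rewrite subrr /dotp big1 ?exprn_gt0// => i _; rewrite mxE mul0r.
pose A := [set w | ~ Omega w /\ dotp (w - z') (w - z') <= dotp (z - z') (z - z')].
have zz' : dotp (z - z') (z - z') < h ^+ 2.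
  by move: z'z; rewrite /= -opprB dotpNl dotpC dotpNl opprK.
have Az : A z by split.
have cptA : compact A.
  apply: bounded_closed_compact; last first.
    apply: closedI; first by apply: open_closedC.
    by apply: closed_le_fun => //; exact: continuous_const.
  apply: (@bounded_dotp _ _ _ (2 * dotp (z - z') (z - z') + 2 * dotp z' z')).
  move=> x [_ xA]; have := dotp_ge0 (x - 2 *: z').
  move: xA; rewrite !(dotpBl, dotpBr, dotpZl, dotpZr) !(dotpC z'); lra.
have [w /set_mem [nOw wz'] wmin] := compact_EVT_min (ex_intro _ z Az) cptA
  (continuous_subspaceT (cdist z')).
have w_neq : z' <> w by move=> E; apply: nOw; rewrite -E.
pose r := Num.sqrt (dotp (z' - w) (z' - w)).
have r0 : 0 < r by rewrite sqrtr_gt0 dotp_gt0.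
have r2 : r ^+ 2 = dotp (z' - w) (z' - w) by rewrite sqr_sqrtr// ltW// dotp_gt0.
have wz'r : dotp (w - z') (w - z') = r ^+ 2.
  by rewrite r2 -opprB dotpNl dotpC dotpNl opprK.
have rh : r < h.
  rewrite -(ltr_pXn2r (n := 2)) ?nnegrE ?ltW// -wz'r.
  exact: le_lt_trans zz'.
pose e := r^-1 *: (z' - w).
have ee : dotp e e = 1 by rewrite dotpZl dotpZr -r2; field; exact: lt0r_neq0.
exists e, (dotp w e); split => //.
  move=> y Oy; rewrite leNgt; apply/negP => ye.
  have ywneg : dotp (y - w) (z' - w) < 0.
    by move: ye; rewrite /e !dotpZr ltr_pM2l ?invr_gt0// dotpBl subr_lt0.
  pose c := - dotp (y - w) (z' - w); pose q := dotp (y - w) (y - w).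
  have c0 : 0 < c by rewrite oppr_gt0.
  have q0 : 0 <= q by exact: dotp_ge0.
  (* A point [y] of Omega on the wrong side is reflected through [w] to [x], on the line from [y]
     through [w]. The squared distance from [x] to [z'] is [r ^ 2 - 2 * s * c + s ^ 2 * q], which is
     below [r ^ 2] once [s * q < 2 * c]; the [+ 1] keeps the denominator positive. Then [x] lies in
     Omega by minimality of [w], and convexity puts [w], between [x] and [y], in Omega as well. *)
  pose s := c / (q + 1).
  have s0 : 0 < s by rewrite divr_gt0// ltr_wpDl.
  have sq : s * q < 2 * c.
    by rewrite /s mulrAC ltr_pdivrMr; nra.
  pose x := w + s *: (w - y).
  have xz' : dotp (x - z') (x - z') < r ^+ 2.
    have -> : x - z' = - (z' - w) - s *: (y - w).
      rewrite /x -(opprB y w) scalerN opprB; exact: addrAC.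
    rewrite r2; move: @c @q @s c0 q0 s0 sq x.
    move: (z' - w) (y - w) => p v /= c0 q0 s0 sq _.
    rewrite dotpBl !dotpNl !dotpZl !(dotpC _ (- p - _)) !dotpBl !dotpNl !dotpZl.
    by rewrite (dotpC p v); nra.
  have Ox : Omega x.
    apply: contrapT => nOx; have := wmin x.
    rewrite wz'r leNgt xz' => /(_ _)/negP; apply => //; apply: mem_set; split => //.
    by rewrite (le_trans (ltW xz'))// -wz'r.
  apply: nOw.
  have s1 : 0 < 1 + s by rewrite addr_gt0.
  have -> : w = (1 + s)^-1 *: x + (s / (1 + s)) *: y.
    apply/rowP => i; rewrite !mxE; field; exact: lt0r_neq0.
  apply: convex_set_comb => //.
  - by rewrite invr_gt0.
  - by rewrite divr_gt0.
  - by field; exact: lt0r_neq0.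
have ze := dotp_lt_unit h0 ee zz'.
have : dotp (z' - w) e = r.
  by rewrite dotpZr -r2; field; exact: lt0r_neq0.
have : h + h = d by rewrite /h; field.
by move: ze; rewrite !dotpBl => ? ? ?; lra.
Qed.

Lemma compact_gt0_lower_bound (R : realType) (T : topologicalType) (A : set T)
    (f : T -> R) :
  compact A -> continuous f -> (forall t, A t -> 0 < f t) ->
  exists2 m, 0 < m & forall t, A t -> m <= f t.
Proof.
move=> cA cf f0; have [A0|A0] := pselect (A !=set0); last first.
  by exists 1 => // t At; exfalso; apply: A0; exists t.
have [c /set_mem Ac cmin] := compact_EVT_min A0 cA (continuous_subspaceT cf).
by exists (f c); [exact: f0|move=> t /mem_set/cmin].
Qed.

(** * Euclidean balls and the polynomial barrier *)

Section euclidean_topology.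
Variables (R : realType) (n : nat).
Implicit Types x v : 'rV[R]_n.

Lemma nbhs_dotp_ball x (Q : set 'rV[R]_n) :
  nbhs x Q -> exists2 r, 0 < r & forall v, dotp (v - x) (v - x) <= r -> Q v.
Proof.
move=> /nbhs_ballP[e /= e0 xQ]; exists (e ^+ 2 / 4); first by rewrite divr_gt0 ?exprn_gt0.
move=> v vr; apply: xQ; split=> // i j; rewrite ord1.
have : (v - x) ord0 j ^+ 2 <= e ^+ 2 / 4.
  apply: le_trans vr; rewrite /dotp (bigD1 j)//= -expr2 lerDl.
  by apply: sumr_ge0 => k _; rewrite -expr2 sqr_ge0.
rewrite !mxE => h; suff : `|v ord0 j - x ord0 j| < e by rewrite distrC.
rewrite -(@ltr_pXn2r _ 2) ?nnegrE ?(ltW e0)// real_normK ?num_real//.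
by apply: le_lt_trans h _; have := exprn_gt0 2 e0; lra.
Qed.

Lemma continuous_sqdist (c : 'rV[R]_n) :
  continuous (fun v => dotp (v - c) (v - c)).
Proof.
by apply: continuous_dotp; apply: continuous_sub; [move=> ?|exact: continuous_const
  |move=> ?|exact: continuous_const].
Qed.

Lemma compact_dotp_ball (c : 'rV[R]_n) (r : R) :
  compact [set v | dotp (v - c) (v - c) <= r].
Proof.
apply: bounded_closed_compact.
  apply: (@bounded_dotp _ _ _ (2 * r + 2 * dotp c c)) => v vr.
  have := dotp_ge0 (v - 2 *: c).
  by move: vr; rewrite /= !(dotpBl, dotpBr, dotpZl, dotpZr) !(dotpC c); lra.
by apply: closed_le_fun; [exact: continuous_sqdist|exact: continuous_const].
Qed.

End euclidean_topology.

(* The sphere on which [sphere_fun] vanishes has [c] and [z] as antipodal points.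
   The quadratic correction in [barrier] does not change the gradient at [z], but
   raises the Laplacian there as much as one wants. *)
Section quartic_barrier.
Variables (R : realType) (n : nat) (c z : 'rV[R]_n) (beta : R).
Let d2 := dotp (z - c) (z - c).
Definition sphere_fun (v : 'rV[R]_n) : R :=
  d2 - dotp (v - c) (v - c) - dotp (v - z) (v - z).
Local Notation s := sphere_fun.
Definition sphere_fun1 (i : 'I_n) (v : 'rV[R]_n) : R :=
  - 2 * (v - c) ord0 i - 2 * (v - z) ord0 i.
Local Notation s1 := sphere_fun1.
Definition barrier (v : 'rV[R]_n) : R := s v + beta * s v ^+ 2.
Definition barrier1 (i : 'I_n) (v : 'rV[R]_n) : R := (1 + 2 * beta * s v) * s1 i v.
Definition barrier2 (i : 'I_n) (v : 'rV[R]_n) : R :=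
  - 4 * (1 + 2 * beta * s v) + 2 * beta * s1 i v ^+ 2.

Lemma sphere_fun_line i h v :
  s (h *: basis_rV R i + v) = s v + h * s1 i v - 2 * h ^+ 2.
Proof.
have E (y : 'rV[R]_n) : dotp (h *: basis_rV R i + v - y) (h *: basis_rV R i + v - y) =
    dotp (v - y) (v - y) + 2 * h * (v - y) ord0 i + h ^+ 2.
  rewrite -addrA !(dotpDl (h *: _)) !(dotpDr _ (h *: _)) !dotpZl !dotpZr.
  by rewrite (dotpC _ (basis_rV R i)) !dotp_basis basis_rVE; ring.
by rewrite /s !E /s1; ring.
Qed.

Lemma sphere_fun1_line i h v : s1 i (h *: basis_rV R i + v) = s1 i v - 4 * h.
Proof. by rewrite /s1 !mxE !eqxx/=; ring. Qed.

Lemma is_derive_barrier i v : is_derive v (basis_rV R i) barrier (barrier1 i v).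
Proof.
apply: (@is_derive_expansion _ _ _ _ _ _ (fun h => - 2 * (1 + 2 * beta * s v) +
    beta * (s1 i v - 2 * h) ^+ 2)).
  suff : continuous (fun h : R => - 2 * (1 + 2 * beta * s v) + beta * (s1 i v - 2 * h) ^+ 2).
    by apply.
  apply: continuous_add; first exact: continuous_const.
  apply: continuous_mul; first exact: continuous_const.
  have lin : continuous (fun h : R => s1 i v - 2 * h).
    by apply: continuous_sub; [exact: continuous_const|exact: mulrl_continuous].
  exact: (continuous_compose lin (@exprn_continuous R 2)).
by move=> h; rewrite /barrier /barrier1 sphere_fun_line; ring.
Qed.

Lemma is_derive_barrier1 i v :
  is_derive v (basis_rV R i) (barrier1 i) (barrier2 i v).
Proof.
apply: (@is_derive_expansion _ _ _ _ _ _ (fun h => 2 * beta * (- 6 * s1 i v + 8 * h))).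
  suff : continuous (fun h : R => 2 * beta * (- 6 * s1 i v + 8 * h)) by apply.
  apply: continuous_mul; first exact: continuous_const.
  apply: continuous_add; first exact: continuous_const.
  exact: mulrl_continuous.
move=> h; rewrite /barrier1 /barrier2 sphere_fun_line sphere_fun1_line; ring.
Qed.

Lemma continuous_sphere_fun : continuous s.
Proof.
apply: continuous_sub; last exact: continuous_sqdist.
by apply: continuous_sub; [exact: continuous_const|exact: continuous_sqdist].
Qed.

Lemma continuous_barrier : continuous barrier.
Proof.
apply: continuous_add; first exact: continuous_sphere_fun.
apply: continuous_mul; first exact: continuous_const.
exact: (continuous_compose continuous_sphere_fun (@exprn_continuous R 2)).
Qed.

End quartic_barrier.

(** The maximality of [f / g] is stated in cross-multiplied form, which still makes sense where [g]
    vanishes and is the form in which maxima are used below. *)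
Lemma compact_ratio_max (R : realType) (T : topologicalType) (A : set T)
    (f g : T -> R) :
  A !=set0 -> compact A -> continuous f -> continuous g ->
  (forall t, A t -> 0 < g t) ->
  exists2 c, A c & forall t, A t -> f t * g c <= f c * g t.
Proof.
move=> A0 cA cf cg g0.
have cfg : {within A, continuous (fun t => f t / g t)}.
  apply: continuous_in_subspaceT => t /set_mem At.
  by apply: cvgM; [exact: cf|apply: cvgV; [exact: lt0r_neq0 (g0 _ At)|exact: cg]].
have [c /set_mem Ac cmax] := compact_EVT_max A0 cA cfg.
exists c => // t At; have := cmax t (mem_set At).
by rewrite ler_pdivrMr ?g0// mulrAC ler_pdivlMr ?g0.
Qed.

(** * The two-point product and functions touching it from above *)

Section two_point_product.
Variables (R : realType) (n : nat) (Omega : set 'rV[R]_n) (u : 'rV[R]_n -> R).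
Variables lam a b : R.
Hypotheses (oO : open Omega) (cO : convex_set Omega) (u2 : Ck 2 Omega u).
Hypothesis u_gt0 : forall x, Omega x -> 0 < u x.
Hypothesis u_eq : forall x, Omega x ->
  laplacian u x - dotp (gradient u x) x = - lam * u x.
Hypothesis ubar_cont : continuous (zero_ext Omega u).
Hypotheses (a0 : 0 < a) (b0 : 0 < b) (ab1 : a + b = 1).

Local Notation ubar := (zero_ext Omega u).
Definition two_point_prod (p : 'rV[R]_n * 'rV[R]_n) : R :=
  ubar p.1 `^ a * ubar p.2 `^ b.
Definition two_point_comb (p : 'rV[R]_n * 'rV[R]_n) : 'rV[R]_n :=
  a *: p.1 + b *: p.2.
Local Notation P := two_point_prod.
Local Notation mid := two_point_comb.

Lemma ubar_ge0 x : 0 <= ubar x.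
Proof. by rewrite /zero_ext; case: ifPn => // /set_mem/u_gt0/ltW. Qed.

Lemma ubar_gt0 x : Omega x -> 0 < ubar x.
Proof. by move=> Ox; rewrite zero_ext_in//; exact: u_gt0. Qed.

Lemma continuous_two_point_comb : continuous mid.
Proof.
apply: continuous_add; apply: continuous_scale; try exact: continuous_const.
  by move=> p; exact: cvg_fst.
by move=> p; exact: cvg_snd.
Qed.

Lemma continuous_two_point_prod : continuous P.
Proof.
apply: continuous_mul; apply: continuous_powR => //.
- by move=> ?; exact: ubar_ge0.
- by apply: (continuous_compose _ ubar_cont) => p; exact: cvg_fst.
- by move=> ?; exact: ubar_ge0.
- by apply: (continuous_compose _ ubar_cont) => p; exact: cvg_snd.
Qed.

Lemma two_point_prod_ge0 p : 0 <= P p.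
Proof. by rewrite mulr_ge0 ?powR_ge0. Qed.

Lemma two_point_prod_gt0 p : 0 < P p -> Omega p.1 /\ Omega p.2.
Proof.
move=> P0; split; apply: contrapT => nO; move: P0; rewrite /two_point_prod.
  by rewrite (zero_ext_out _ nO) powR0 ?gt_eqF// mul0r ltxx.
by rewrite (zero_ext_out _ nO) (@powR0 _ b) ?gt_eqF// mulr0 ltxx.
Qed.

Lemma two_point_comb_in p : Omega p.1 -> Omega p.2 -> Omega (mid p).
Proof. exact: convex_set_comb. Qed.

Lemma ln_two_point_prod p : Omega p.1 -> Omega p.2 ->
  ln (P p) = a * ln (u p.1) + b * ln (u p.2).
Proof.
move=> O1 O2; rewrite /two_point_prod !zero_ext_in// lnM ?posrE ?powR_gt0 ?u_gt0//.
by rewrite !ln_powR.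
Qed.

(** Since [C * u] satisfies the equation exactly, it drops out and only the perturbation [w]
    remains. Near [p] all factors are positive, so logarithms turn the maximal quotient into the
    difference treated by [two_point_max_operator]. *)
Lemma barrier_max_operator (C : R) (w : 'rV[R]_n -> R)
    (w1 w2 : 'I_n -> 'rV[R]_n -> R) (p : 'rV[R]_n * 'rV[R]_n) :
  continuous w ->
  (forall i x, is_derive x (basis_rV R i) w (w1 i x)) ->
  (forall i x, is_derive x (basis_rV R i) (w1 i) (w2 i x)) ->
  0 < P p -> 0 < C * ubar (mid p) + w (mid p) ->
  (\forall q \near p, P q * (C * ubar (mid p) + w (mid p)) <=
                      P p * (C * ubar (mid q) + w (mid q))) ->
  - lam * w (mid p) <=
    \sum_(i < n) w2 i (mid p) - \sum_(i < n) w1 i (mid p) * mid p ord0 i.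
Proof.
case: p => x y; set z := mid (x, y) => cw dw1 dw2 P0 g0 max.
have [/= Ox Oy] := two_point_prod_gt0 P0.
have Oz : Omega z by exact: two_point_comb_in.
have nO v : Omega v -> \forall v' \near v, Omega v'.
  by move=> Ov; apply: open_nbhs_nbhs; split.
pose g v := C * u v + w v.
have gE v : Omega v -> g v = C * ubar v + w v by move=> Ov; rewrite /g zero_ext_in.
have cg : continuous (fun v => C * ubar v + w v).
  by apply: continuous_add => //; apply: continuous_mul => //; exact: continuous_const.
have gpos : \forall v \near z, 0 < g v.
  have /cvgr_gt /(_ _ g0) := cg z; apply: filterS2 (nO _ Oz) => v Ov.
  by rewrite -gE.
have dg1 i : \forall v \near z,
    is_derive v (basis_rV R i) g (C * partial i u v + w1 i v).
  apply: filterS (nO _ Oz) => v Ov.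
  exact: is_deriveD (is_deriveZ C (Ck2_is_derive u2 i Ov)) (dw1 i v).
have dg2 i : is_derive z (basis_rV R i) (fun v => C * partial i u v + w1 i v)
    (C * partial i (partial i u) z + w2 i z).
  exact: is_deriveD (is_deriveZ C (Ck2_is_derive2 u2 i Oz)) (dw2 i z).
have nxy : \forall q \near (x, y), Omega q.1 /\ Omega q.2.
  by exists (Omega, Omega) => /=; [split; exact: nO|move=> q []].
have gmax : \forall q \near (x, y),
    a * ln (u q.1) + b * ln (u q.2) - ln (g (a *: q.1 + b *: q.2)) <=
    a * ln (u x) + b * ln (u y) - ln (g z).
  have gposq := continuous_two_point_comb gpos.
  near=> q.
  have [q1 q2] : Omega q.1 /\ Omega q.2 by near: q.
  have gq : 0 < g (mid q) by near: q; exact: gposq.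
  have gz : 0 < g z by exact: nbhs_singleton gpos.
  have Oq : Omega (mid q) by exact: two_point_comb_in.
  have Pq : 0 < P q by rewrite mulr_gt0 ?powR_gt0 ?ubar_gt0.
  have -> := esym (ln_two_point_prod (p := (x, y)) Ox Oy).
  rewrite -ln_two_point_prod// lerBlDr addrAC lerBrDr -!lnM ?posrE//.
  rewrite ler_ln ?posrE ?(mulr_gt0, powR_gt0, ubar_gt0)//.
  rewrite -/(mid q) !gE//.
  by near: q; exact: max.
have := @two_point_max_operator _ _ _ _ lam oO u2 u_gt0 u_eq g
  (fun i v => C * partial i u v + w1 i v)
  (fun i v => C * partial i (partial i u) v + w2 i v) x y a b a0 b0 ab1 Ox Oy
  gpos dg1 dg2 gmax.
rewrite -/(mid (x, y)) -/z !big_split/= -!mulr_sumr.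
under [X in _ - X]eq_bigr do rewrite mulrDl -mulrA.
rewrite big_split/= -mulr_sumr -/(laplacian u z) /g.
have : \sum_(i < n) partial i u z * z ord0 i = dotp (gradient u z) z.
  by apply: eq_bigr => i _; rewrite [gradient u z _ _]mxE.
move=> ->; have := u_eq Oz.
move: (laplacian u z) (dotp _ z) => l d /eqP; rewrite subr_eq => /eqP ->.
by move: (\sum_(i < n) w2 i z) (\sum_(i < n) _) => S1 S2; lra.
Unshelve. all: by end_near. Qed.

(** A half-space containing Omega, which need not touch it: written this way, the admissible pairs
    are cut out by closed conditions. *)
Definition unit_support (e : 'rV[R]_n) (c : R) : Prop :=
  dotp e e = 1 /\ forall v, Omega v -> c <= dotp v e.

(** * Domination up to the boundary *)

Section boundary_layer.
Variable B : R.
Hypotheses (B0 : 0 < B) (OB : forall v, Omega v -> dotp v v < B ^+ 2).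
(** The drift of the profile [phi] below contributes at most [B], and its zero order term at most
    twice [|lam|], as [phi <= 2]; the second derivative [- 2 * M] outweighs both. The width [d] is
    the point where the derivative of [phi] vanishes, so [phi] is strictly increasing on
    [[0, d]]. *)
Let M := B + 2 * `|lam| + 1.
Let d := (2 * M)^-1.

Let M1 : 1 <= M. Proof. by rewrite lerDr addr_ge0 ?mulr_ge0// ltW. Qed.
Let M0 : 0 < M. Proof. by rewrite (lt_le_trans ltr01). Qed.
Let d0 : 0 < d. Proof. by rewrite invr_gt0 mulr_gt0. Qed.
Let Md : M * d = 1 / 2. Proof. by rewrite /d; field; exact: lt0r_neq0. Qed.
Let d1 : d <= 1 / 2. Proof. by have := M1; have := Md; have := d0; nra. Qed.

(** For convex Omega these are the points at distance at least [d] from the boundary. In this form a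
    point of Omega outside the core comes with the half-space needed for the barrier. *)
Definition layer_core : set 'rV[R]_n := [set z | Omega z /\
  forall e c, unit_support e c -> d <= dotp z e - c].

(* The operator applied to [v |-> phi (dotp v e - c)] is negative where
   [0 <= dotp v e - c <= d], for every unit vector [e]. *)
Let phi (s : R) := 1 + s - M * s ^+ 2.

Let phi_ge1 s : 0 <= s <= d -> 1 <= phi s.
Proof.
move=> /andP[s0 sd]; rewrite /phi -addrA lerDl subr_ge0 expr2 mulrA.
by rewrite ler_piMl//; have := Md; have := M0; nra.
Qed.

Let phi_le2 s : 0 <= s <= d -> phi s <= 2.
Proof.
move=> /andP[s0 sd]; rewrite /phi; have : 0 <= M * s ^+ 2 by rewrite mulr_ge0 ?sqr_ge0 ?ltW.
have := d1; lra.
Qed.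

Let phi_lt s s' : 0 <= s <= d -> 0 <= s' < d -> phi s <= phi s' -> s < d.
Proof.
move=> /andP[s0 sd] /andP[s'0 s'd] ss'; rewrite lt_neqAle sd andbT; apply/eqP => E.
move: ss'; rewrite E /phi leNgt => /negP; apply; have := Md; have := M0; nra.
Qed.

(* Among the half-spaces containing [Omega] the ratio selects the nearest one, so
   that no regularity of the distance to the boundary is needed. *)
Lemma layer_domination (C : R) : 0 < C ->
  (forall p, layer_core (mid p) -> P p <= C * ubar (mid p)) ->
  forall p, P p <= C * ubar (mid p).
Proof.
move=> C0 core p1; rewrite leNgt; apply/negP => p1P.
have p1_gt0 : 0 < P p1 by apply: le_lt_trans p1P; rewrite mulr_ge0 ?ubar_ge0 ?ltW.
have [Ox1 Oy1] := two_point_prod_gt0 p1_gt0.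
have Oz1 := two_point_comb_in Ox1 Oy1.
have noncore p : Omega (mid p) -> C * ubar (mid p) < P p ->
    exists e c, unit_support e c /\ 0 <= dotp (mid p) e - c < d.
  move=> Op pP; apply: contrapT => nS; move: pP; rewrite ltNge => /negP; apply.
  apply: core; split=> // e c ec; rewrite leNgt; apply/negP => lt_d.
  by apply: nS; exists e, c; split=> //; rewrite lt_d subr_ge0 ec.2.
have [e1 [c1 [S1 l1]]] := noncore _ Oz1 p1P.
(* Dividing by 3 while [phi <= 2] leaves the perturbed function below [P] at [p1], hence also at the
   pair where the quotient is largest. *)
pose k := (P p1 - C * ubar (mid p1)) / 3.
have k0 : 0 < k by rewrite divr_gt0// subr_gt0.
pose l (t : ('rV[R]_n * 'rV[R]_n) * ('rV[R]_n * R)) := dotp (mid t.1) t.2.1 - t.2.2.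
(* The two points range over a closed ball instead of Omega, which makes [T] closed; pairs leaving
   Omega are harmless because [P] vanishes there. *)
pose T := [set t : ('rV[R]_n * 'rV[R]_n) * ('rV[R]_n * R) |
  [/\ dotp t.1.1 t.1.1 <= B ^+ 2, dotp t.1.2 t.1.2 <= B ^+ 2,
      unit_support t.2.1 t.2.2 & 0 <= l t <= d]].
have inT p e c : Omega p.1 -> Omega p.2 -> unit_support e c ->
    dotp (mid p) e - c <= d -> T (p, (e, c)).
  move=> O1 O2 ec lc; split => //=; [exact/ltW/OB|exact/ltW/OB|].
  by rewrite /l/= lc andbT subr_ge0 ec.2//; exact: two_point_comb_in.
have c_fst : continuous (fun t : ('rV[R]_n * 'rV[R]_n) * ('rV[R]_n * R) => t.1).
  by move=> t; exact: cvg_fst.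
have c_snd : continuous (fun t : ('rV[R]_n * 'rV[R]_n) * ('rV[R]_n * R) => t.2).
  by move=> t; exact: cvg_snd.
have c_x : continuous (fun t : ('rV[R]_n * 'rV[R]_n) * ('rV[R]_n * R) => t.1.1).
  by apply: (continuous_compose c_fst) => p; exact: cvg_fst.
have c_y : continuous (fun t : ('rV[R]_n * 'rV[R]_n) * ('rV[R]_n * R) => t.1.2).
  by apply: (continuous_compose c_fst) => p; exact: cvg_snd.
have c_e : continuous (fun t : ('rV[R]_n * 'rV[R]_n) * ('rV[R]_n * R) => t.2.1).
  by apply: (continuous_compose c_snd) => p; exact: cvg_fst.
have c_c : continuous (fun t : ('rV[R]_n * 'rV[R]_n) * ('rV[R]_n * R) => t.2.2).
  by apply: (continuous_compose c_snd) => p; exact: cvg_snd.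
have c_mid : continuous (fun t : ('rV[R]_n * 'rV[R]_n) * ('rV[R]_n * R) => mid t.1).
  exact: (continuous_compose c_fst continuous_two_point_comb).
have c_l : continuous l by apply: continuous_sub => //; exact: continuous_dotp.
have cT : compact T.
  have lt_B1 (v e' : 'rV[R]_n) : dotp e' e' = 1 -> dotp v v <= B ^+ 2 -> dotp v e' < B + 1.
    move=> ee vB; apply: dotp_lt_unit => //; first by rewrite addr_gt0.
    by apply: le_lt_trans vB _; rewrite sqrrD1; have := B0; nra.
  have cD r : compact [set v : 'rV[R]_n | dotp v v <= r].
    apply: bounded_closed_compact; first exact: (@bounded_dotp _ _ _ r).
    apply: closed_le_fun; last exact: continuous_const.
    by apply: continuous_dotp => v.
  apply: (@subclosed_compact _ _ (([set v : 'rV[R]_n | dotp v v <= B ^+ 2] `*`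
      [set v : 'rV[R]_n | dotp v v <= B ^+ 2]) `*`
      ([set v : 'rV[R]_n | dotp v v <= 1] `*` `[- (B + 2), B + 2]%classic))).
  - rewrite (_ : T = [set t | dotp t.1.1 t.1.1 <= B ^+ 2] `&`
        [set t | dotp t.1.2 t.1.2 <= B ^+ 2] `&`
        [set t | dotp t.2.1 t.2.1 <= 1] `&` [set t | 1 <= dotp t.2.1 t.2.1] `&`
        \bigcap_(v in Omega) [set t | t.2.2 <= dotp v t.2.1] `&`
        [set t | 0 <= l t] `&` [set t | l t <= d]); last first.
      apply/seteqP; split => t.
        by move=> [h1 h2 [h3 h4] /andP[h5 h6]]; repeat split => //=; rewrite h3.
      move=> [[[[[[h1 h2] h3] h4] h5] h6] h7]; split => //=; last exact/andP.
      by split=> //; apply/eqP; rewrite eq_le h3.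
    have cstr r : continuous (fun _ : ('rV[R]_n * 'rV[R]_n) * ('rV[R]_n * R) => r : R).
      exact: continuous_const.
    apply: closedI; last exact: closed_le_fun.
    apply: closedI; last exact: closed_le_fun.
    apply: closedI; last first.
      apply: closed_bigI => v _; apply: closed_le_fun => //.
      by apply: continuous_dotp => //; exact: continuous_const.
    have ce2 := continuous_dotp c_e c_e.
    apply: closedI; last exact: (closed_le_fun (cstr 1) ce2).
    apply: closedI; last exact: (closed_le_fun ce2 (cstr 1)).
    apply: closedI; last exact: (closed_le_fun (continuous_dotp c_y c_y) (cstr _)).
    exact: (closed_le_fun (continuous_dotp c_x c_x) (cstr _)).
  - repeat apply: compact_setX => //; exact: segment_compact.
  - move=> [[x y] [e c]] [/= h1 h2 [h3 h4] /andP[h5 h6]]; split=> //=.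
    split=> /=; first by rewrite h3.
    rewrite in_itv/=; move: h5 h6; rewrite /l /two_point_comb /= dotpDl !dotpZl.
    have hx := lt_B1 x e h3 h1; have hy := lt_B1 y e h3 h2.
    have hx' : dotp (- x) e < B + 1.
      by apply: lt_B1 => //; rewrite dotpNl dotpC dotpNl opprK.
    have hy' : dotp (- y) e < B + 1.
      by apply: lt_B1 => //; rewrite dotpNl dotpC dotpNl opprK.
    move: hx hy hx' hy'; rewrite !dotpNl => hx hy hx' hy' h5 h6.
    have := d1; move: h5 h6 ab1 a0 b0 => ? ? ? ? ? ?.
    by apply/andP; split; nra.
pose g (t : ('rV[R]_n * 'rV[R]_n) * ('rV[R]_n * R)) :=
  C * ubar (mid t.1) + k * phi (l t).
have c_P : continuous (fun t : ('rV[R]_n * 'rV[R]_n) * ('rV[R]_n * R) => P t.1).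
  exact: (continuous_compose c_fst continuous_two_point_prod).
have c_phi : continuous phi.
  apply: continuous_sub.
    by apply: continuous_add; [exact: continuous_const|move=> ?].
  apply: continuous_mul; first exact: continuous_const.
  exact: exprn_continuous.
have c_g : continuous g.
  apply: continuous_add; apply: continuous_mul; try exact: continuous_const.
    exact: (continuous_compose c_mid ubar_cont).
  exact: (continuous_compose c_l c_phi).
have g_gt0 t : T t -> 0 < g t.
  move=> [_ _ _ /phi_ge1 ph]; rewrite ltr_wpDl ?mulr_ge0 ?ubar_ge0 ?ltW//.
  by rewrite mulr_gt0// (lt_le_trans ltr01).
have T1 : T (p1, (e1, c1)) by apply: inT => //; case/andP: l1 => _ /ltW.
have [[p [e c]] Tp pmax] := compact_ratio_max (ex_intro _ _ T1) cT c_P c_g g_gt0.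
have g1_lt : g (p1, (e1, c1)) < P p1.
  case: T1 => _ _ _ /phi_le2 ph; rewrite /g/=.
  have : k * phi (l (p1, (e1, c1))) <= k * 2 by rewrite ler_pM2l.
  have : k * 3 = P p1 - C * ubar (mid p1) by rewrite /k divfK.
  move: k0; rewrite /=; lra.
have gp : 0 < g (p, (e, c)) by exact: g_gt0.
have gP : g (p, (e, c)) < P p.
  have /= h := pmax _ T1.
  rewrite -(ltr_pM2r (g_gt0 _ T1)); apply: lt_le_trans h.
  by rewrite mulrC ltr_pM2r.
have p0 : 0 < P p := lt_trans gp gP.
have [Ox Oy] := two_point_prod_gt0 p0; have Oz := two_point_comb_in Ox Oy.
case: (Tp) => _ _ /= Sec lp.
(* The constraint [l <= d] has to be inactive for the maximum to be local in the pair. As [P]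
   exceeds [C * ubar] here, some half-space has depth below [d]; comparing with it at the same pair
   and using the monotonicity of [phi] excludes [l = d]. *)
have l_lt : l (p, (e, c)) < d.
  have [|e' [c' [S' /andP[l'0 l'd]]]] := noncore p Oz.
    apply: le_lt_trans gP; rewrite /g/= lerDl mulr_ge0 ?(ltW k0)//.
    by rewrite (le_trans ler01)// phi_ge1.
  apply: (@phi_lt _ (l (p, (e', c')))) => //; first by rewrite l'0.
  have /= := pmax (p, (e', c')) (inT _ _ _ Ox Oy S' (ltW l'd)).
  by rewrite ler_pM2l// /g/= lerD2l ler_pM2l.
pose w v := k * phi (dotp v e - c).
pose w1 (i : 'I_n) (v : 'rV[R]_n) := k * (1 - 2 * M * (dotp v e - c)) * e ord0 i.
pose w2 (i : 'I_n) (v : 'rV[R]_n) := - k * 2 * M * e ord0 i ^+ 2.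
have c_le : continuous (fun v => dotp v e - c).
  apply: continuous_sub; last exact: continuous_const.
  by apply: continuous_dotp; [move=> ?|exact: continuous_const].
have lin (i : 'I_n) h v : dotp (h *: basis_rV R i + v) e = h * e ord0 i + dotp v e.
  by rewrite dotpDl dotpZl dotp_basis.
have := @barrier_max_operator C w w1 w2 p _ _ _ p0 gp.
have cw : continuous w.
  apply: continuous_mul; first exact: continuous_const.
  exact: (continuous_compose c_le c_phi).
have dw1 i v : is_derive v (basis_rV R i) w (w1 i v).
  apply: (@is_derive_expansion _ _ _ _ _ _ (cst (- k * M * e ord0 i ^+ 2))).
    exact: continuous_const.
  by move=> h; rewrite /w /w1 lin /phi/=; ring.
have dw2 i v : is_derive v (basis_rV R i) (w1 i) (w2 i v).
  apply: (@is_derive_expansion _ _ _ _ _ _ (cst 0)); first exact: continuous_const.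
  by move=> h; rewrite /w1 /w2 lin/=; ring.
have Tnear : \forall q \near p, T (q, (e, c)).
  have c_lp : continuous (fun q : 'rV[R]_n * 'rV[R]_n => dotp (mid q) e - c).
    exact: (continuous_compose continuous_two_point_comb c_le).
  have /cvgr_lt/(_ _ l_lt) := c_lp p.
  have : \forall q \near p, Omega q.1 /\ Omega q.2.
    exists (Omega, Omega) => /=; last by move=> q [].
    by split; apply: open_nbhs_nbhs; split.
  by apply: filterS2 => q [q1 q2] /ltW ql; exact: inT.
have zB : - B < dotp (mid p) e.
  rewrite ltrNl -dotpNl; apply: dotp_lt_unit => //; first by case: Sec.
  by rewrite dotpNl dotpC dotpNl opprK; exact: OB.
have pmax' : \forall q \near p,
    P q * (C * ubar (mid p) + w (mid p)) <= P p * (C * ubar (mid q) + w (mid q)).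
  by apply: filterS Tnear => q; exact: pmax.
move=> /(_ cw dw1 dw2 pmax'); apply/negP; rewrite -ltNge.
have -> : \sum_(i < n) w2 i (mid p) = k * (- 2 * M).
  have -> : k * (- 2 * M) = k * (- 2 * M) * dotp e e by rewrite Sec.1 mulr1.
  by rewrite /dotp mulr_sumr; apply: eq_bigr => i _; rewrite /w2; ring.
have -> : \sum_(i < n) w1 i (mid p) * mid p ord0 i =
    k * ((1 - 2 * M * l (p, (e, c))) * dotp (mid p) e).
  rewrite /dotp 2!mulr_sumr; apply: eq_bigr => i _.
  by rewrite /w1 /l/=; ring.
rewrite -mulrBr /w -/(l (p, (e, c))) mulrCA ltr_pM2l//.
have l1M : 2 * M * l (p, (e, c)) <= 1.
  by case/andP: lp => _ ld; have := Md; have := M0; nra.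
have lM0 : 0 <= 2 * M * l (p, (e, c)) by case/andP: lp => l0 _; rewrite mulr_ge0// mulr_ge0// ltW.
have ME : M = B + 2 * `|lam| + 1 by [].
have f2 := phi_le2 lp; have f1 := phi_ge1 lp.
have lN := ler_norm lam; have N0 := normr_ge0 lam.
move: M (phi (l (p, (e, c)))) (2 * M * l (p, (e, c))) (dotp (mid p) e) `|lam| f1 f2 l1M lM0 zB lN N0 ME.
move=> M' f q ze N f1 f2 q1 q0 zB lN N0 ->.
have : lam * f <= 2 * N by nra.
have : - ((1 - q) * ze) <= B.
  have : 0 <= (1 - q) * (ze + B) by apply: mulr_ge0; lra.
  have : 0 <= q * B by apply: mulr_ge0 => //; exact: ltW.
  by lra.
have := B0; lra.
Qed.

End boundary_layer.

(** * A strong maximum principle for the contact set *)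

Section strong_maximum.
Variables (B C : R).
Hypotheses (OB : forall v, Omega v -> dotp v v < B ^+ 2) (C1 : 1 < C).
Hypothesis dom : forall p, P p <= C * ubar (mid p).

Definition touching : set 'rV[R]_n := [set z | Omega z /\
  exists2 p, mid p = z & P p = C * ubar z].

Let C0 : 0 < C. Proof. exact: lt_trans C1. Qed.

Lemma compact_pairs (N : set 'rV[R]_n) : closed N ->
  compact [set p | [/\ dotp p.1 p.1 <= B ^+ 2, dotp p.2 p.2 <= B ^+ 2 & N (mid p)]].
Proof.
move=> cN; have cD : compact [set v : 'rV[R]_n | dotp v v <= B ^+ 2].
  by have := @compact_dotp_ball R n 0 (B ^+ 2); under eq_set do rewrite subr0.
rewrite (_ : [set p | _] = ([set v : 'rV[R]_n | dotp v v <= B ^+ 2] `*`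
  [set v : 'rV[R]_n | dotp v v <= B ^+ 2]) `&` mid @^-1` N); last first.
  by apply/seteqP; split=> p [] => [? ? ?|[]].
apply: compact_closedI; first exact: compact_setX.
by apply: preimage_closed => // p _; exact: continuous_two_point_comb.
Qed.

Lemma pair_bounded p : 0 < P p ->
  dotp p.1 p.1 <= B ^+ 2 /\ dotp p.2 p.2 <= B ^+ 2.
Proof. by move=> /two_point_prod_gt0[/OB/ltW ? /OB/ltW]. Qed.

Lemma touching_gt0 z : touching z -> 0 < C * ubar z.
Proof. by move=> [Oz _]; rewrite mulr_gt0// ubar_gt0. Qed.

(** The set is the image under [mid] of a compact set of pairs; [dom] lets the contact equality be
    replaced by a closed inequality. *)
Lemma compact_touching (N : set 'rV[R]_n) : closed N -> N `<=` Omega ->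
  compact (touching `&` N).
Proof.
move=> cN NO; have cP := continuous_two_point_prod.
have cCu : continuous (fun p => C * ubar (mid p)).
  apply: continuous_mul; first exact: continuous_const.
  exact: (continuous_compose continuous_two_point_comb ubar_cont).
rewrite (_ : _ `&` _ = mid @` ([set p | [/\ dotp p.1 p.1 <= B ^+ 2,
    dotp p.2 p.2 <= B ^+ 2 & N (mid p)]] `&` [set p | C * ubar (mid p) <= P p])).
  apply: continuous_compact.
    exact/continuous_subspaceT/continuous_two_point_comb.
  apply: compact_closedI; first exact: compact_pairs.
  exact: closed_le_fun.
apply/seteqP; split=> [z [tz Nz]|_ [p [[h1 h2 h3] h4] <-]].
  have z0 := touching_gt0 tz; case: tz => Oz [p pz Pz].
  have p0 : 0 < P p by rewrite Pz.
  exists p => //; have [? ?] := pair_bounded p0.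
  by split=> /=; [split=> //; rewrite pz|rewrite Pz pz].
split=> //; split; first exact: NO.
by exists p => //; apply/eqP; rewrite eq_le dom.
Qed.

(* Hopf's argument: the ball with diameter [c, z] meets [touching] at [z] only, so
   [C * ubar] lowered by a small multiple of the barrier is touched from below
   near [z], at a point where it is a strict supersolution. *)
Lemma no_touching_ball (c z : 'rV[R]_n) (d := dotp (z - c) (z - c)) :
  touching z -> 0 < d -> (forall v, touching v -> d <= dotp (v - c) (v - c)) -> False.
Proof.
move=> tz d0 far; have Cz0 := touching_gt0 tz; have [Oz [pz pzE Ppz]] := tz.
pose zc := dotp (z - c) z.
(* At [z] the operator applied to the barrier is [- 4 * n + 8 * beta * d + 2 * zc]; this [beta]
   makes it at least 1. *)
pose beta := (4 * n%:R + 2 * `|zc| + 1) / (8 * d).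
have n0 : 0 <= n%:R :> R by [].
have beta0 : 0 < beta.
  by rewrite divr_gt0 ?mulr_gt0//; have := normr_ge0 zc; lra.
pose s := sphere_fun c z.
pose q := barrier c z beta.
pose G v := \sum_(i < n) barrier2 c z beta i v -
  \sum_(i < n) barrier1 c z beta i v * v ord0 i + lam * q v.
have sz : s z = 0 by rewrite /s /sphere_fun !subrr dotp0l subr0.
have qz : q z = 0 by rewrite /q /barrier -/s sz expr0n/= mulr0 addr0.
have s_touch v : touching v -> s v <= - dotp (v - z) (v - z).
  by move=> /far; rewrite /s /sphere_fun -/d; lra.
have cs : continuous s by exact: continuous_sphere_fun.
have cq : continuous q by exact: continuous_barrier.
have cG : continuous G.
  have ccoord i : continuous (fun v : 'rV[R]_n => v ord0 i) by exact: coord_continuous.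
  have cdiff y : continuous (fun v : 'rV[R]_n => v - y).
    by apply: continuous_sub; [move=> ?|exact: continuous_const].
  have cs1 i : continuous (sphere_fun1 c z i).
    apply: continuous_sub; apply: continuous_mul; try exact: continuous_const.
      exact: continuous_coord (cdiff c).
    exact: continuous_coord (cdiff z).
  have c12 : continuous (fun v => 1 + 2 * beta * s v).
    apply: continuous_add; first exact: continuous_const.
    by apply: continuous_mul => //; exact: continuous_const.
  apply: continuous_add; last first.
    by apply: continuous_mul => //; exact: continuous_const.
  apply: continuous_sub; apply: continuous_sum => i.
    apply: continuous_add; apply: continuous_mul; try exact: continuous_const.
      exact: c12.
    exact: (continuous_compose (cs1 i) (@exprn_continuous R 2)).
  apply: continuous_mul; last exact: ccoord.
  by apply: continuous_mul; [exact: c12|exact: cs1].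
have Gz : 0 < G z.
  rewrite /G qz mulr0 addr0.
  have s1z i : sphere_fun1 c z i z = - 2 * (z - c) ord0 i.
    by rewrite /sphere_fun1 subrr [(0 : 'rV_n) _ _]mxE mulr0 subr0.
  have -> : \sum_(i < n) barrier2 c z beta i z = - 4 * n%:R + 8 * beta * d.
    rewrite /d /dotp mulr_sumr.
    have -> : - 4 * n%:R = \sum_(i < n) (- 4 : R).
      by rewrite sumr_const card_ord mulr_natr.
    rewrite -big_split/=; apply: eq_bigr => i _.
    by rewrite /barrier2 -/s sz s1z; ring.
  have -> : \sum_(i < n) barrier1 c z beta i z * z ord0 i = - 2 * zc.
    rewrite /zc /dotp mulr_sumr; apply: eq_bigr => i _.
    by rewrite /barrier1 -/s sz s1z; ring.
  have -> : 8 * beta * d = 4 * n%:R + 2 * `|zc| + 1.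
    by rewrite /beta; field; exact: lt0r_neq0.
  have := ler_norm (- zc); rewrite normrN; lra.
(* The last condition gives [q = s * (1 + beta * s)] the sign of [s]: without it the quadratic term
   could make [q] positive outside the ball. *)
have [r r0 Nr] : exists2 r, 0 < r & forall v, dotp (v - z) (v - z) <= r ->
    [/\ Omega v, 0 < G v & - 1 < beta * s v].
  apply: nbhs_dotp_ball.
  have cbs : continuous (fun v => beta * s v).
    by apply: continuous_mul => //; exact: continuous_const.
  near=> v; split; near: v.
  - by apply: open_nbhs_nbhs; split.
  - have /cvgr_gt := cG z; exact.
  - have /cvgr_gt := cbs z; apply; rewrite sz mulr0; lra.
pose N := [set v | dotp (v - z) (v - z) <= r].
have clN : closed N by apply: closed_le_fun; [exact: continuous_sqdist|exact: continuous_const].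
have cN : compact N by exact: compact_dotp_ball.
have cP := continuous_two_point_prod.
have cmid := continuous_two_point_comb.
have cCu : continuous (fun p => C * ubar (mid p)).
  apply: continuous_mul; first exact: continuous_const.
  exact: (continuous_compose cmid ubar_cont).
pose A := [set p | [/\ dotp p.1 p.1 <= B ^+ 2, dotp p.2 p.2 <= B ^+ 2 & N (mid p)]].
have cA : compact A by exact: compact_pairs.
have cds : continuous (fun p => dotp (mid p - z) (mid p - z)).
  exact: (continuous_compose cmid (@continuous_sqdist _ _ z)).
have csm : continuous (fun p => s (mid p)) by exact: (continuous_compose cmid cs).
(* Pairs whose image lies on the sphere bounding [N] and in the closed ball where [s] is
   nonnegative. Contacts with [s] nonnegative occur at [z] only, so compactness leaves a uniform gap
   [eta] between [P] and [C * ubar]. *)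
pose Bd := A `&` [set p | r <= dotp (mid p - z) (mid p - z)] `&` [set p | 0 <= s (mid p)].
have cBd : compact Bd.
  apply: compact_closedI.
    by apply: compact_closedI => //; apply: closed_le_fun => //; exact: continuous_const.
  by apply: closed_le_fun => //; exact: continuous_const.
have [eta eta0 etaP] : exists2 m, 0 < m & forall p, Bd p -> m <= C * ubar (mid p) - P p.
  apply: compact_gt0_lower_bound => //; first exact: continuous_sub.
  move=> p [[[_ _ /Nr[Op _ _]] /= rp] sp]; rewrite subr_gt0 lt_neqAle dom andbT.
  apply/eqP => E; have : touching (mid p) by split=> //; exists p.
  by move=> /s_touch; move: sp rp r0 => /=; lra.
have [m m0 mP] : exists2 m, 0 < m & forall v, N v -> m <= C * ubar v.
  apply: compact_gt0_lower_bound => //.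
    by apply: continuous_mul => //; exact: continuous_const.
  by move=> v /Nr[Ov _ _]; rewrite mulr_gt0// ubar_gt0.
pose Q := d + beta * d ^+ 2.
have Q0 : 0 < Q by rewrite addr_gt0// mulr_gt0// exprn_gt0.
have s_le v : s v <= d.
  rewrite /s /sphere_fun -/d; have := dotp_ge0 (v - c); have := dotp_ge0 (v - z); lra.
have q_le v : 0 <= s v -> q v <= Q.
  move=> sv; rewrite /q /barrier -/s /Q lerD// ler_pM2l//.
  by rewrite ler_pXn2r ?nnegrE// ltW.
have q_lt0 v : N v -> s v < 0 -> q v < 0.
  move=> /Nr[_ _ bs] sv; rewrite /q /barrier -/s.
  have -> : s v + beta * s v ^+ 2 = s v * (1 + beta * s v) by ring.
  rewrite nmulr_rlt0//; lra.
(* As [q <= Q] where [s] is nonnegative, the perturbation is there smaller than the gap [eta], and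
   smaller than [m], so that [g] stays positive on [N]. *)
pose eps := Num.min eta m / (2 * Q).
have min0 : 0 < Num.min eta m by rewrite lt_min eta0 m0.
have eps0 : 0 < eps by rewrite divr_gt0// mulr_gt0.
have epsQ : eps * Q < Num.min eta m.
  have -> : eps * Q = Num.min eta m / 2 by rewrite /eps; field; exact: lt0r_neq0.
  by rewrite ltr_pdivrMr// ltr_pMr// ltr1n.
pose w v := - eps * q v.
have cw : continuous w by apply: continuous_mul => //; exact: continuous_const.
pose g p := C * ubar (mid p) + w (mid p).
have w_ge v : 0 <= s v -> - (eps * Q) <= w v.
  by move=> /q_le h; rewrite /w mulNr lerN2 ler_pM2l.
have w_gt0 v : N v -> s v < 0 -> 0 < w v.
  by move=> Nv sv; rewrite /w mulNr oppr_gt0 pmulr_rlt0// q_lt0.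
have g_gt0 p : A p -> 0 < g p.
  move=> [_ _ Np]; have mp := mP _ Np; have [sp|sp] := ltP (s (mid p)) 0.
    by rewrite /g addr_gt0//; [exact: lt_le_trans mp|exact: w_gt0].
  have := w_ge _ sp; rewrite /g.
  have : eps * Q < m by rewrite (lt_le_trans epsQ)// ge_min lexx orbT.
  lra.
have Apz : A pz.
  have pz0 : 0 < P pz by rewrite Ppz.
  have [? ?] := pair_bounded pz0; split=> //.
  by rewrite /N pzE/= subrr dotp0l ltW.
have cg : continuous g.
  by apply: continuous_add => //; exact: (continuous_compose cmid cw).
have [p Ap pmax] := compact_ratio_max (ex_intro _ _ Apz) cA cP cg g_gt0.
have gp0 := g_gt0 _ Ap.
(* At [pz] the perturbation vanishes and [g = P], so the maximal quotient is at least 1. *)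
have gP : g p <= P p.
  have := pmax _ Apz; have -> : g pz = P pz by rewrite /g pzE /w qz mulr0 addr0.
  by rewrite mulrC ler_pM2r// Ppz.
have p0 : 0 < P p by exact: lt_le_trans gP.
have [Ox Oy] := two_point_prod_gt0 p0.
have [_ _ Np] := Ap.
(* On the bounding sphere [g] exceeds [P]: outside the ball because [w] is positive, inside it
   because of the gap [eta]. Hence the maximum is interior. *)
have dp : dotp (mid p - z) (mid p - z) < r.
  rewrite ltNge; apply/negP => rp.
  have [sp|sp] := ltP (s (mid p)) 0.
    have := w_gt0 _ Np sp; have := dom p; move: gP; rewrite /g; lra.
  have := etaP p (conj (conj Ap rp) sp); have := w_ge _ sp.
  have : eps * Q < eta by rewrite (lt_le_trans epsQ)// ge_min lexx.
  move: gP; rewrite /g; lra.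
have pnear : \forall p' \near p,
    P p' * (C * ubar (mid p) + w (mid p)) <= P p * (C * ubar (mid p') + w (mid p')).
  have /cvgr_lt/(_ _ dp) := cds p.
  have : \forall p' \near p, Omega p'.1 /\ Omega p'.2.
    exists (Omega, Omega) => /=; last by move=> p' [].
    by split; apply: open_nbhs_nbhs; split.
  apply: filterS2 => p' [px py] dp'; apply: pmax.
  by split; [exact/ltW/OB|exact/ltW/OB|exact: ltW].
have dw1 i v : is_derive v (basis_rV R i) w (- eps * barrier1 c z beta i v).
  have h : is_derive v (basis_rV R i) q (barrier1 c z beta i v).
    exact: is_derive_barrier.
  exact: (is_deriveZ (- eps) h).
have dw2 i v : is_derive v (basis_rV R i) (fun v => - eps * barrier1 c z beta i v)
    (- eps * barrier2 c z beta i v).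
  have h : is_derive v (basis_rV R i) (barrier1 c z beta i) (barrier2 c z beta i v).
    exact: is_derive_barrier1.
  exact: (is_deriveZ (- eps) h).
have := barrier_max_operator cw dw1 dw2 p0 gp0 pnear.
have [_ Gp _] := Nr _ Np.
under [X in _ - X]eq_bigr do rewrite -mulrA.
rewrite -!mulr_sumr /w; move: Gp; rewrite /G.
move: (\sum_(i < n) _) (\sum_(i < n) _) (q _) => S2 S1 q' Gp.
have := mulr_gt0 eps0 Gp; lra.
Unshelve. all: by end_near. Qed.

(** The segment from a contact point to a maximum point of [ubar] meets the contact set at a last
    parameter [tb]. A centre [c] slightly beyond it and a contact point nearest to [c] form the
    configuration excluded by [no_touching_ball]. *)
Lemma touching_empty : ~ (touching !=set0).
Proof.
move=> [z0 tz0]; have Oz0 := tz0.1.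
pose D := [set v : 'rV[R]_n | dotp (v - 0) (v - 0) <= B ^+ 2].
have DO v : Omega v -> D v by move=> Ov; rewrite /D/= subr0 ltW// OB.
have [zs _ zsmax] := compact_EVT_max (ex_intro _ z0 (DO _ Oz0))
  (@compact_dotp_ball R n 0 (B ^+ 2)) (continuous_subspaceT ubar_cont).
have ub_le v : ubar v <= ubar zs.
  have [Ov|Ov] := pselect (Omega v); last by rewrite (zero_ext_out _ Ov) ubar_ge0.
  by apply: zsmax; apply/mem_set; exact: DO.
have zs0 : 0 < ubar zs := lt_le_trans (ubar_gt0 Oz0) (ub_le z0).
have Ozs : Omega zs.
  by apply: contrapT => nO; move: zs0; rewrite (zero_ext_out _ nO) ltxx.
(* [P] is at most [ubar zs] everywhere, since the exponents sum to 1, while a contact at [zs] would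
   give the value [C * ubar zs], which is larger as [C > 1]. *)
have ntzs : ~ touching zs.
  move=> [_ [p _ Pp]].
  have : P p <= ubar zs.
    rewrite -[leRHS]powRr1 ?ubar_ge0// -ab1 powRD; last first.
      by rewrite (gt_eqF zs0) implybT.
    by rewrite ler_pM ?powR_ge0// ge0_ler_powR ?nnegrE ?ubar_ge0 ?(ltW a0) ?(ltW b0).
  by rewrite Pp leNgt => /negP; apply; rewrite ltr_pMl.
pose gam (t : R) := z0 + t *: (zs - z0).
have cgam : continuous gam.
  apply: continuous_add; first exact: continuous_const.
  by apply: continuous_scale; [move=> ?|exact: continuous_const].
pose S := gam @` `[0, 1]%classic.
have cS : compact S.
  by apply: continuous_compact; [exact: continuous_subspaceT|exact: segment_compact].
have gamE t : gam t = (1 - t) *: z0 + t *: zs.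
  by rewrite /gam scalerBl scale1r scalerBr -addrA [- _ + _]addrC.
have gamO t : 0 <= t <= 1 -> Omega (gam t).
  move=> /andP[t0 t1]; rewrite gamE.
  have [->|tn0] := eqVneq t 0; first by rewrite subr0 scale1r scale0r addr0.
  have [->|tn1] := eqVneq t 1; first by rewrite subrr scale1r scale0r add0r.
  apply: convex_set_comb => //; last by rewrite subrK.
    by rewrite subr_gt0 lt_neqAle tn1.
  by rewrite lt_neqAle eq_sym tn0.
have SO : S `<=` Omega by move=> _ [t /= t01 <-]; apply: gamO; rewrite in_itv in t01.
have clS : closed S by apply: compact_closed => //; exact: norm_hausdorff.
have clt : closed (touching `&` S).
  by apply: compact_closed; [exact: norm_hausdorff|exact: compact_touching].
pose A := `[0, 1]%classic `&` gam @^-1` (touching `&` S).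
have cA : compact A.
  apply: compact_closedI; first exact: segment_compact.
  by apply: preimage_closed => // t _; exact: cgam.
have A0 : A 0.
  split; first by rewrite /= in_itv/= lexx ler01.
  by rewrite /preimage/= gamE subr0 scale1r scale0r addr0; split=> //; exists 0;
    rewrite ?gamE ?subr0 ?scale1r ?scale0r ?addr0//= in_itv/= lexx ler01.
have cid : continuous (fun t : R => t) by move=> ?.
have [tb /set_mem[/= tb01 [ttb _]] tbmax] :=
  compact_EVT_max (ex_intro _ 0 A0) cA (continuous_subspaceT cid).
have Am t : 0 <= t <= 1 -> touching (gam t) -> t <= tb.
  move=> t01 tt; apply: tbmax; apply: mem_set; split; first by rewrite /= in_itv.
  by split=> //; exists t => //=; rewrite in_itv.
rewrite in_itv/= in tb01; case/andP: tb01 => tb0 tb1.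
have {}tb1 : tb < 1.
  rewrite lt_neqAle tb1 andbT; apply/eqP => E; apply: ntzs; move: ttb.
  by rewrite E gamE subrr scale0r scale1r add0r.
have [r r0 Br] := nbhs_dotp_ball (open_nbhs_nbhs (conj oO ttb.1)).
(* By the parallelogram law, a point as close to [c] as [w0] is has squared distance at most
   [4 * rho] from [w0]; the bound [r / 4] therefore keeps the whole ball [N] in Omega. *)
have [t [tbt t1 tr]] : exists t, [/\ tb < t, t <= 1 &
    dotp (gam tb - gam t) (gam tb - gam t) < r / 4].
  have cdt : continuous (fun t => dotp (gam tb - gam t) (gam tb - gam t)).
    by apply: continuous_dotp; apply: continuous_sub => //; exact: continuous_const.
  have r4 : dotp (gam tb - gam tb) (gam tb - gam tb) < r / 4.
    by rewrite subrr dotp0l divr_gt0.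
  have /cvgr_lt/(_ _ r4) ntb := cdt tb.
  near (tb : R)^'+ => t; exists t; split; near: t.
  - exact: nbhs_right_gt.
  - exact: nbhs_right_le.
  - exact: cvg_within ntb.
set c := gam t in tr; set w0 := gam tb in tr ttb Br.
have t01 : 0 <= t <= 1 by rewrite t1 andbT ltW// (le_lt_trans tb0).
have ntc : ~ touching c by move=> /(Am _ t01); rewrite leNgt tbt.
pose rho := dotp (w0 - c) (w0 - c).
pose N := [set v | dotp (v - c) (v - c) <= rho].
have NO : N `<=` Omega.
  move=> v vN; apply: Br; have := dotp_ge0 ((v - c) + (w0 - c)).
  have -> : v - w0 = (v - c) - (w0 - c) by rewrite opprB addrA subrK.
  move: vN tr; rewrite /N/= /rho; move: (v - c) (w0 - c) => p q.
  by rewrite !(dotpBl, dotpDl) !(dotpBr, dotpDr) (dotpC q p); lra.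
have clN : closed N.
  by apply: closed_le_fun; [exact: continuous_sqdist|exact: continuous_const].
have [z /set_mem[tz zN] zmin] := compact_EVT_min
  (ex_intro _ w0 (conj ttb (lexx _ : N w0))) (compact_touching clN NO)
  (continuous_subspaceT (@continuous_sqdist _ _ c)).
apply: (@no_touching_ball c z tz).
  by apply: dotp_gt0 => E; apply: ntc; rewrite -E.
move=> v tv; have [vr|vr] := leP (dotp (v - c) (v - c)) rho.
  by apply: zmin; exact: mem_set.
exact: le_trans zN (ltW vr).
Unshelve. all: by end_near. Qed.

End strong_maximum.

(** * The two-point inequality and convexity *)

(** Omega may be replaced by its closure in the definition of the core: a boundary point has depth
    less than [d] in some almost supporting half-space. *)
Lemma closed_layer_core (B : R) : 0 < B -> closed (layer_core B).
Proof.
move=> B0.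
have d0 : 0 < (2 * (B + 2 * `|lam| + 1))^-1.
  by rewrite invr_gt0 mulr_gt0// ltr_wpDr// ltr_wpDr// mulr_ge0.
rewrite (_ : layer_core B = closure Omega `&`
    \bigcap_(ec in [set ec : 'rV[R]_n * R | unit_support ec.1 ec.2])
      [set z | (2 * (B + 2 * `|lam| + 1))^-1 <= dotp z ec.1 - ec.2]).
  apply: closedI; first exact: closed_closure.
  apply: closed_bigI => -[e c] _; apply: closed_le_fun; first exact: continuous_const.
  apply: continuous_sub; last exact: continuous_const.
  by apply: continuous_dotp; [move=> ?|exact: continuous_const].
apply/seteqP; split=> [z [Oz zS]|z [clz zS]].
  by split; [exact: subset_closure|move=> [e c]; exact: zS].
split; last by move=> e c ec; exact: (zS (e, c)).
apply: contrapT => nOz.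
have [e [c [ee Oe lt_d]]] := convex_set_almost_support oO cO clz nOz d0.
by have := zS (e, c) (conj ee Oe); rewrite /= leNgt lt_d.
Qed.

Lemma two_point_prod_le : bounded_set Omega -> forall p, P p <= ubar (mid p).
Proof.
move=> [M [_ OM]] p0; rewrite leNgt; apply/negP => p0_lt.
have /two_point_prod_gt0[Ox _] : 0 < P p0 by apply: le_lt_trans p0_lt; exact: ubar_ge0.
(* The bound on the maximum norm is summed over the coordinates; adding 1 makes [B ^ 2] exceed that
   sum without taking a root. *)
pose B := n%:R * (`|M| + 1) ^+ 2 + 1.
have nM0 : 0 <= n%:R * (`|M| + 1) ^+ 2 :> R by rewrite mulr_ge0 ?sqr_ge0.
have B0 : 0 < B by rewrite ltr_wpDl.
have OB v : Omega v -> dotp v v < B ^+ 2.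
  move=> /OM vM; have {}vM : `|v| <= `|M| + 1.
    by apply: vM; rewrite (le_lt_trans (ler_norm _))// ltrDl.
  have : dotp v v <= n%:R * (`|M| + 1) ^+ 2.
    rewrite mulr_natl -[X in _ *+ X]card_ord -sumr_const; apply: ler_sum => i _.
    rewrite -expr2 -real_normK ?num_real// lerXn2r ?nnegrE ?addr_ge0//.
    apply: le_trans vM; rewrite [leRHS]mx_normrE.
    by apply/bigmax_geP; right; exists (ord0, i).
  by rewrite /B; nra.
have clK := closed_layer_core B0.
pose A := [set p : 'rV[R]_n * 'rV[R]_n | [/\ dotp p.1 p.1 <= B ^+ 2,
  dotp p.2 p.2 <= B ^+ 2 & layer_core B (mid p)]].
have cA : compact A by exact: compact_pairs.
have inA p : 0 < P p -> layer_core B (mid p) -> A p.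
  by move=> /(pair_bounded OB)[? ?] ?; split.
have cCu : continuous (fun p => ubar (mid p)).
  exact: (continuous_compose continuous_two_point_comb ubar_cont).
have Kgt0 p : A p -> 0 < ubar (mid p) by move=> [_ _ [Oz _]]; exact: ubar_gt0.
(* If no pair lies over the core, then [P] satisfies the core hypothesis with any positive constant;
   [2^-1] is contradicted on the diagonal, where [P] equals [ubar]. *)
have [A0|A0] := pselect (A !=set0); last first.
  have : P (p0.1, p0.1) <= 2^-1 * ubar (mid (p0.1, p0.1)).
    apply: (layer_domination B0 OB) => [|p Kp]; first by rewrite invr_gt0.
    rewrite leNgt; apply/negP => lt_P; apply: A0; exists p; apply: inA => //.
    by apply: le_lt_trans lt_P; rewrite mulr_ge0 ?ubar_ge0 ?invr_ge0.
  rewrite /two_point_prod /two_point_comb/= -scalerDl ab1 scale1r -powRD ?ab1; last first.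
    by rewrite oner_eq0.
  by rewrite powRr1 ?ubar_ge0//; have := ubar_gt0 Ox; lra.
have [p1 Ap1 p1max] := compact_ratio_max A0 cA continuous_two_point_prod cCu Kgt0.
have z1_gt0 := Kgt0 _ Ap1.
pose C := P p1 / ubar (mid p1).
have core p : layer_core B (mid p) -> P p <= C * ubar (mid p).
  move=> Kp; have [Pp|Pp] := ltP 0 (P p); last first.
    apply: le_trans Pp _; rewrite mulr_ge0 ?ubar_ge0// divr_ge0 ?ubar_ge0//.
    exact: two_point_prod_ge0.
  by rewrite /C mulrAC ler_pdivlMr//; apply: p1max; exact: inA.
have [C1|C1] := leP C 1.
  have : P p0 <= 1 * ubar (mid p0).
    apply: (layer_domination B0 OB) => // p Kp; apply: le_trans (core _ Kp) _.
    by rewrite ler_wpM2r ?ubar_ge0.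
  by rewrite mul1r leNgt p0_lt.
have dom := layer_domination B0 OB (lt_trans ltr01 C1) core.
apply: (touching_empty OB C1 dom); exists (mid p1); split.
  by case: Ap1 => _ _ [].
by exists p1 => //; rewrite /C divfK// lt0r_neq0.
Qed.

End two_point_product.

Theorem theorem1p7 (R : realType) (n : nat) (Omega : set 'rV[R]_n)
    (u : 'rV[R]_n -> R) :
  open Omega -> bounded_set Omega -> convex_set Omega ->
  eigenfunction Omega u ->
  convex_function Omega (fun x => - ln (u x)).
Proof.
move=> oO bO cO [u2 uc u_eq u_gt0 u_bd] t x y /set_mem Ox /set_mem Oy.
(* The endpoints are set apart because a zero exponent would keep [P] from vanishing when the
   corresponding point leaves Omega. *)
have [->|t0] := eqVneq t 0%:i01; first by rewrite !conv0.
have [->|t1] := eqVneq t 1%:i01; first by rewrite !conv1.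
pose a : R := t%:num; pose b : R := 1 - a.
have a0 : 0 < a by rewrite /a lt_neqAle eq_sym t0 ge0.
have b0 : 0 < b by rewrite subr_gt0 /a lt_neqAle t1 le1.
have ab1 : a + b = 1 by rewrite addrC subrK.
have ubar_cont := zero_ext_continuous oO uc u_bd.
have := two_point_prod_le oO cO u2 u_gt0 u_eq ubar_cont a0 b0 ab1 bO (x, y).
have Oz : Omega (a *: x + b *: y) by exact: convex_set_comb.
rewrite zero_ext_in//= -ler_ln ?posrE ?u_gt0//; last first.
  by rewrite mulr_gt0 ?powR_gt0 ?zero_ext_in ?u_gt0.
rewrite (ln_two_point_prod a b u_gt0 (p := (x, y)) Ox Oy)/= => h.
suff -> : conv t (- ln (u x) : R^o) (- ln (u y) : R^o) =
    - (a * ln (u x) + b * ln (u y)) by rewrite lerN2.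
by rewrite convRE opprD !mulrN.
Qed.
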